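(* Given an oracle that solves $2$-gap $\mathrm{CVP}_\infty$, for every $\varepsilon\in(0,1]$ one can solve $(1+\varepsilon)$-gap $\mathrm{CVP}_\infty$ using at most $2^n\cdot(2+\log 1/\varepsilon)^n$ oracle calls. Moreover, the encoding size of the instance in each oracle query is polynomial in $n$, in the encoding length of the original instance, and in $\log 1/\varepsilon$.
   Context: For $A\in\mathbb{Q}^{n\times n}$, $\Lambda(A)=\{Ax:x\in\mathbb{Z}^n\}$. For $\alpha\ge1$, the $\alpha$-gap $\mathrm{CVP}_\infty$ problem is: given a lattice $\Lambda(A)$, a target vector $t\in\mathbb{Q}^n$ and a number $D>0$, either find a lattice vector $v\in\Lambda(A)$ with $\|v-t\|_\infty\le D$, or assert that all lattice vectors $v\in\Lambda(A)$ satisfy $\|v-t\|_\infty>\alpha^{-1}D$. Logarithms are base 2. *)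

(* Defs.v *)
From HB Require Import structures.
From mathcomp Require Import all_boot all_order all_algebra.
From mathcomp Require Import all_classical all_reals all_analysis.

Set Implicit Arguments.
Unset Strict Implicit.
Unset Printing Implicit Defensive.

Import Order.TTheory GRing.Theory Num.Theory.
Local Open Scope ring_scope.

Definition log2 (R : realType) (x : R) : R := ln x / ln 2.

Definition poly3 (R : pzRingType) (d : nat) (c : nat -> nat -> nat -> R)
    (x y z : R) : R :=
  \sum_(i < d) \sum_(j < d) \sum_(k < d)
     c i j k * x ^+ i * y ^+ j * z ^+ k.

(** * The gap closest vector problem *)

Record instance := Instance {
  cvp_dim : nat;
  cvp_basis : 'M[rat]_cvp_dim;
  cvp_target : 'cV[rat]_cvp_dim;
  cvp_radius : rat;
  cvp_radius_gt0 : 0 < cvp_radius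
}.

Definition in_lattice (n : nat) (A : 'M[rat]_n) (v : 'cV[rat]_n) : Prop :=
  exists x : 'cV[int]_n, v = A *m map_mx intr x.

(* mx_norm is the maximum of the absolute values of the entries.
   None stands for the assertion that no lattice vector is close. *)
Definition gap_cvp_answer (R : realType) (alpha : R) (I : instance)
    (ans : option 'cV[rat]_(cvp_dim I)) : Prop :=
  match ans with
  | Some v =>
      in_lattice (cvp_basis I) v /\ mx_norm (v - cvp_target I) <= cvp_radius I
  | None =>
      forall v : 'cV[rat]_(cvp_dim I), in_lattice (cvp_basis I) v ->
        alpha^-1 * ratr (cvp_radius I) < ratr (mx_norm (v - cvp_target I))
  end.

Definition oracle := forall I : instance, option 'cV[rat]_(cvp_dim I).

Definition solves_gap_cvp (R : realType) (alpha : R) (O : oracle) : Prop :=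
  forall I : instance, gap_cvp_answer alpha (O I).

(** * Binary encoding length *)

Definition nat_size (n : nat) : nat := (trunc_log 2 n).+1.

(* The leading 1 is the sign bit. *)
Definition rat_size (q : rat) : nat :=
  (1 + nat_size `|numq q| + nat_size `|denq q|)%N.

Definition instance_size (I : instance) : nat :=
  let n := cvp_dim I in
  (n + \sum_(i < n) \sum_(j < n) rat_size (cvp_basis I i j)
   + \sum_(i < n) rat_size (cvp_target I i 0%R) + rat_size (cvp_radius I))%N.

(** * Oracle programs

    Algorithms are while programs on a random access machine with logarithmic
    (bit) cost. The memory is a family of unbounded arrays of rationals:
    [m a i] is the i-th cell of array [a]. Every primitive operation is
    computable in time polynomial in the bit lengths of its operands and
    result, which is what it is charged for. *)

Definition memory := nat -> nat -> rat.

Inductive binop := Add | Sub | Mul | Div | Leq.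

Inductive expr :=
| Cst of rat
| Get of nat & expr
| Bin of binop & expr & expr.

Definition eval_binop (o : binop) (x y : rat) : rat :=
  match o with
  | Add => x + y
  | Sub => x - y
  | Mul => x * y
  | Div => x / y
  | Leq => if x <= y then 1 else 0
  end.

Fixpoint eval (m : memory) (e : expr) : rat :=
  match e with
  | Cst q => q
  | Get a i => m a (Num.truncn (eval m i))
  | Bin o e1 e2 => eval_binop o (eval m e1) (eval m e2)
  end.

Fixpoint eval_cost (m : memory) (e : expr) : nat :=
  (rat_size (eval m e) +
   match e with
   | Cst _ => 0
   | Get _ i => eval_cost m i
   | Bin _ e1 e2 => eval_cost m e1 + eval_cost m e2
   end)%N.

Definition update (m : memory) (a i : nat) (q : rat) : memory :=
  fun b j => if (b == a) && (j == i) then q else m b j.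

(* An instance occupies four consecutive arrays: the dimension, the basis in
   row-major order, the target and the radius. *)
Definition holds_instance (m : memory) (a : nat) (I : instance) : Prop :=
  [/\ m a 0%N = (cvp_dim I)%:R,
      forall i j : 'I_(cvp_dim I),
        m a.+1 (i * cvp_dim I + j)%N = cvp_basis I i j,
      forall i : 'I_(cvp_dim I), m a.+2 i = cvp_target I i 0
    & m a.+3 0%N = cvp_radius I].

(* An answer occupies two consecutive arrays: a flag telling whether a vector
   has been found, and the vector. *)
Definition holds_answer (m : memory) (a n : nat) (ans : option 'cV[rat]_n)
    : Prop :=
  match ans with
  | Some v => m a 0%N = 1 /\ forall i : 'I_n, m a.+1 i = v i 0
  | None => m a 0%N = 0
  end.

Definition write_answer (m : memory) (a n : nat) (ans : option 'cV[rat]_n)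
    : memory :=
  match ans with
  | Some v => fun b j =>
      if b == a.+1 then if insub j is Some i then v i 0 else m b j
      else update m a 0 1 b j
  | None => update m a 0 0
  end.

Inductive cmd :=
| Assign of nat & expr & expr
| Seq of cmd & cmd
| If of expr & cmd & cmd
| While of expr & cmd
| Query of nat & nat.

(* [exec O c m m' T qs]: with oracle [O], the program [c] started in [m]
   terminates in [m'] after time [T], having made the oracle queries [qs] in
   this order. [Assign a i e] is a[i] := e. [Query a b] submits the instance
   held at [a] and gets the answer at [b]; it blocks if no valid instance is
   held at [a]. *)
Inductive exec (O : oracle) :
    cmd -> memory -> memory -> nat -> seq instance -> Prop :=
| exec_assign m a i e :
    exec O (Assign a i e) m (update m a (Num.truncn (eval m i)) (eval m e))
      (eval_cost m i + eval_cost m e)%N [::]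
| exec_seq c1 c2 m m1 m2 T1 T2 q1 q2 :
    exec O c1 m m1 T1 q1 -> exec O c2 m1 m2 T2 q2 ->
    exec O (Seq c1 c2) m m2 (T1 + T2)%N (q1 ++ q2)
| exec_if_true e c1 c2 m m1 T q :
    eval m e != 0 -> exec O c1 m m1 T q ->
    exec O (If e c1 c2) m m1 (eval_cost m e + T)%N q
| exec_if_false e c1 c2 m m1 T q :
    eval m e = 0 -> exec O c2 m m1 T q ->
    exec O (If e c1 c2) m m1 (eval_cost m e + T)%N q
| exec_while_true e c m m1 m2 T1 T2 q1 q2 :
    eval m e != 0 -> exec O c m m1 T1 q1 ->
    exec O (While e c) m1 m2 T2 q2 ->
    exec O (While e c) m m2 (eval_cost m e + T1 + T2)%N (q1 ++ q2)
| exec_while_false e c m :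
    eval m e = 0 -> exec O (While e c) m m (eval_cost m e) [::]
| exec_query a b m I :
    holds_instance m a I ->
    exec O (Query a b) m (write_answer m b (O I)) (instance_size I) [:: I].

Definition initial (m : memory) (I : instance) : Prop :=
  holds_instance m 0 I /\ forall a i : nat, (3 < a)%N -> m a i = 0.

(* Programs leave their own answer in arrays 4 and 5. *)
Definition outputs (m : memory) (n : nat) (ans : option 'cV[rat]_n) : Prop :=
  holds_answer m 4 ans.

(* Main.v *)
Require Import Defs.
From Stdlib Require List.
From HB Require Import structures.
From mathcomp Require Import all_boot all_order all_algebra.
From mathcomp Require Import all_classical all_reals all_analysis.
From mathcomp Require Import zify ring lra.

(* [Defs.eval] is shadowed by a constant of the same name in [all_analysis]. *)
Import Defs.
Import Order.TTheory GRing.Theory Num.Theory.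
Local Open Scope ring_scope.

(** Let [D] be the radius. An axis-parallel box becomes a cube after rescaling
    each row of the basis, so a single call to the 2-gap oracle either finds a
    lattice vector in a box or shows that the concentric box of half the size
    contains none. On each axis, for [j < k] and both signs, take the interval
    between [+-D (1 - 2^-j)] and [+-D (1 - 2^-(j+1))]: doubled about its center
    it stays inside [[-D, D]], and these [2 k] intervals cover
    [[-D (1 - 2^-k), D (1 - 2^-k)]]. With [k = floor (log (1/eps)) + 2] this
    contains [[-D/(1+eps), D/(1+eps)]], and the [(2 k)^n] products of intervals
    are tried one after the other, in the order of an odometer in base [2 k].
    All numbers that occur have polynomial bit length; for the vectors returned
    by the oracle this is because their denominators divide products of
    denominators of basis entries. *)

(** * Bit lengths *)

Lemma ltn_exp_nat_size n : (n < 2 ^ nat_size n)%N.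
Proof. exact: trunc_log_ltn. Qed.

Lemma nat_size_le n b : (0 < b)%N -> (n < 2 ^ b)%N -> (nat_size n <= b)%N.
Proof.
move=> b0 nb; rewrite /nat_size; case: n nb => [|n] nb;
  first by rewrite trunc_log0.
by rewrite -(ltn_exp2l _ _ (isT : (1 < 2)%N)) (leq_ltn_trans _ nb)// trunc_logP.
Qed.

Lemma leq_nat_size a b : (a <= b)%N -> (nat_size a <= nat_size b)%N.
Proof.
by move=> ab; apply: nat_size_le => //;
  apply: leq_ltn_trans ab (ltn_exp_nat_size b).
Qed.

Lemma nat_sizeM a b : (nat_size (a * b) <= nat_size a + nat_size b)%N.
Proof.
apply: nat_size_le => //; rewrite expnD.
by have := ltn_exp_nat_size a; have := ltn_exp_nat_size b; nia.
Qed.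

Lemma leq_expn2_addM a b : (0 < a -> 0 < b -> 2 ^ a + 2 ^ b <= 2 ^ (a + b))%N.
Proof.
case: a b => [//|a] [//|b] _ _; rewrite addnS addSn !expnS expnD.
have: (0 < 2 ^ a)%N by rewrite expn_gt0.
have: (0 < 2 ^ b)%N by rewrite expn_gt0.
by nia.
Qed.

Lemma nat_sizeD a b : (nat_size (a + b) <= nat_size a + nat_size b)%N.
Proof.
apply: nat_size_le => //.
apply: leq_trans (leq_expn2_addM (nat_size a) (nat_size b) isT isT).
by rewrite -addSn leq_add ?ltn_exp_nat_size// ltnW// ltn_exp_nat_size.
Qed.

Lemma nat_size_leS n : (nat_size n <= n.+1)%N.
Proof. by apply: nat_size_le => //; apply: ltn_trans (ltn_expl _ _). Qed.

Lemma rat_size_ge3 q : (3 <= rat_size q)%N.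
Proof. by rewrite /rat_size /nat_size; lia. Qed.

(* Reduction to lowest terms can only shrink numerator and denominator. *)
Lemma rat_size_ratio (q : rat) (a d : int) : d != 0 -> q * d%:~R = a%:~R ->
  (rat_size q <= 1 + nat_size `|a| + nat_size `|d|)%N.
Proof.
move=> d0 qd.
have e : numq q * d = a * denq q.
  apply: (intr_inj (R := rat)); rewrite !rmorphM /= -qd -{2}(divq_num_den q).
  by rewrite mulrAC divfK// intr_eq0 denq_neq0.
have e' : (`|numq q| * `|d| = `|a| * `|denq q|)%N by rewrite -!abszM e.
have hd : (`|denq q| %| `|d|)%N.
  by rewrite -(@Gauss_dvdr _ `|numq q|) ?e' ?dvdn_mull// coprime_sym
    coprime_num_den.
have d0' : (0 < `|d|)%N by rewrite absz_gt0.
have le_d : (`|denq q| <= `|d|)%N by apply: dvdn_leq.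
have le_a : (`|numq q| <= `|a|)%N.
  by rewrite -(leq_pmul2r d0') e' leq_mul2l le_d orbT.
by rewrite /rat_size !leq_add ?leq_nat_size.
Qed.

Lemma rat_size_mul x y : (rat_size (x * y) <= rat_size x + rat_size y)%N.
Proof.
have h : (rat_size (x * y) <= 1 + nat_size `|(numq x * numq y)%R| + nat_size
  `|(denq x * denq y)%R|)%N.
  apply: rat_size_ratio; first by rewrite mulf_neq0 ?denq_neq0.
  rewrite !rmorphM /= -{1}(divq_num_den x) -{1}(divq_num_den y).
  by rewrite mulrACA divfK ?divfK ?intr_eq0 ?denq_neq0// mulrACA !divfK
    ?intr_eq0 ?denq_neq0.
move: h; rewrite !abszM /rat_size.
have := nat_sizeM `|numq x| `|numq y|; have := nat_sizeM `|denq x| `|denq y|.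
lia.
Qed.

Lemma rat_size_inv x : (rat_size x^-1 <= rat_size x)%N.
Proof.
have [->|x0] := eqVneq x 0; first by rewrite invr0.
apply: (@leq_trans (1 + nat_size `|denq x| + nat_size `|numq x|)%N).
  apply: rat_size_ratio; first by rewrite numq_eq0.
  rewrite -{1}(divq_num_den x) invf_div divfK// intr_eq0 numq_eq0//.
by rewrite /rat_size; lia.
Qed.

Lemma rat_size_div x y : (rat_size (x / y) <= rat_size x + rat_size y)%N.
Proof. exact: leq_trans (rat_size_mul _ _) (leq_add _ (rat_size_inv _)). Qed.

Lemma rat_size_opp x : rat_size (- x) = rat_size x.
Proof. by rewrite /rat_size numqN denqN abszN. Qed.

(** Over the common denominator the numerator is a sum of two cross products, so each denominator
    enters the estimate twice; hence the factor 2. *)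
Lemma rat_size_add x y : (rat_size (x + y) <= 2 * (rat_size x + rat_size y))%N.
Proof.
have h : (rat_size (x + y) <= 1 + nat_size `|(numq x * denq y + numq y * denq
  x)%R|
      + nat_size `|(denq x * denq y)%R|)%N.
  apply: rat_size_ratio; first by rewrite mulf_neq0 ?denq_neq0.
  rewrite !rmorphD !rmorphM /= -{1}(divq_num_den x) -{1}(divq_num_den y).
  have := denq_neq0 x; have := denq_neq0 y.
  rewrite -!(intr_eq0 rat) => ? ?; field; exact/andP.
move: h; rewrite /rat_size.
have := nat_sizeM `|numq x| `|denq y|; have := nat_sizeM `|numq y| `|denq x|.
have := nat_sizeM `|denq x| `|denq y|; rewrite -!abszM.
have := nat_sizeD `|(numq x * denq y)%R| `|(numq y * denq x)%R|.
have /leq_nat_size : (`|(numq x * denq y + numq y * denq x)%R| <=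
  `|(numq x * denq y)%R| + `|(numq y * denq x)%R|)%N by lia.
lia.
Qed.

Lemma rat_size_sub x y : (rat_size (x - y) <= 2 * (rat_size x + rat_size y))%N.
Proof. by rewrite -(rat_size_opp y) rat_size_add. Qed.

(** Linear in [n] rather than in its logarithm. This suffices for small constants, row and column
    indices and interval indices. *)
Lemma rat_size_nat n : (rat_size n%:R <= n + 3)%N.
Proof.
rewrite /rat_size -[n%:R]/((n : int)%:~R) numq_int denq_int.
by have := nat_size_leS n; rewrite absz_nat /= /nat_size trunc_log1; lia.
Qed.

(** Here a bound linear in the exponent is essential: the scales go up to [2 ^ k], which is of order
    [1 / eps]. *)
Lemma rat_size_exp2 n : (rat_size (2 ^+ n) <= n + 3)%N.
Proof.
have -> : 2 ^+ n = (2 ^ n)%:R :> rat by rewrite natrX.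
rewrite /rat_size -[(2 ^ n)%:R]/(((2 ^ n)%N : int)%:~R) numq_int denq_int
  absz_nat.
by rewrite /= /nat_size trunc_log1 trunc_expnK//; lia.
Qed.

(* The denominator of an integer combination divides the product of the
   denominators of the coefficients. *)
Lemma lattice_coord_size n (A : 'M[rat]_n) (v t : 'cV[rat]_n) (D : rat) i :
  in_lattice A v -> `|v i 0 - t i 0| <= D ->
  (rat_size (v i 0%R) <=
     2 * (\sum_(j < n) rat_size (A i j) + rat_size (t i 0%R) + rat_size D +
       2))%N.
Proof.
move=> [x ->]; set q := (_ *m _) i 0 => qt.
pose P := (\prod_(j < n) `|denq (A i j)|)%N.
have P0 : (0 < P)%N by rewrite prodn_gt0// => j; rewrite absz_gt0 denq_neq0.
have Pq : exists a : int, q * P%:R = a%:~R.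
  (* Expand [q] and multiply by [P]: in term [j] the factor of [P] at [j] cancels the denominator of
     [A i j], and the other factors remain. *)
  exists (\sum_j numq (A i j) * x j 0 * \prod_(l < n | l != j) denq (A i l)).
  rewrite /q mxE mulr_suml rmorph_sum; apply: eq_bigr => j _ /=.
  rewrite /P (bigD1 j)//= natrM !rmorphM /= !mxE.
  have -> : (\prod_(l < n | l != j) `|denq (A i l)|)%N%:R =
     (\prod_(l < n | l != j) denq (A i l))%:~R :> rat.
    rewrite natr_prod rmorph_prod; apply: eq_bigr => l _ /=.
    by rewrite -[denq (A i l)]absz_denq.
  have -> : `|denq (A i j)|%N%:R = (denq (A i j))%:~R :> rat.
    by rewrite -[denq (A i j)]absz_denq.
  rewrite mulrA; congr (_ * _); rewrite -{1}(divq_num_den (A i j)).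
  by rewrite mulrAC divfK// intr_eq0 denq_neq0.
case: Pq => a qa.
have := @rat_size_ratio q a P; rewrite absz_nat => /(_ _ qa) h.
have {}h : (rat_size q <= 1 + nat_size `|a| + nat_size P)%N by apply: h; lia.
have lt_P : (P <= 2 ^ \sum_(j < n) rat_size (A i j))%N.
  rewrite /P; elim/big_rec2: _ => [//|j y1 y2 _ hy]; rewrite expnD leq_mul//.
  apply: leq_trans (ltnW (ltn_exp_nat_size _)) _; rewrite leq_exp2l// /rat_size;
    lia.
have numle (r : rat) : `|r| <= (2 ^ rat_size r)%:R.
  apply: (@le_trans _ _ (`|numq r|%N%:R)); last first.
    rewrite ler_nat; apply: leq_trans (ltnW (ltn_exp_nat_size _)) _.
    by rewrite leq_exp2l// /rat_size; lia.
  rewrite -{1}(divq_num_den r) normrM normfV ler_pdivrMr ?normr_gt0 ?intr_eq0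
    ?denq_neq0//.
  rewrite natr_absz intr_norm ler_peMr// -intr_norm.
  by have := denq_neq0 r; rewrite -[1]/(1%:~R) ler_int; lia.
(* Since [a = q * P] and [q] is within [D] of [t i 0], the absolute value of [a] is at most
   [(|t i 0| + |D|) * P]. *)
have lt_a : (`|a| <= 2 ^ (\sum_(j < n) rat_size (A i j) + rat_size (t i 0%R) +
  rat_size D))%N.
  rewrite -(ler_nat rat) natr_absz intr_norm -qa normrM.
  rewrite -addnA expnD natrM mulrC ler_pM// ?normr_nat ?ler_nat//.
  apply: (@le_trans _ _ (`|t i 0| + `|D|)).
    have := le_trans qt (ler_norm D); have := ler_normD (q - t i 0) (t i 0).
    by rewrite subrK; lra.
  apply: le_trans (lerD (numle _) (numle _)) _.
  by rewrite -natrD ler_nat leq_expn2_addM.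
have {}lt_a : (nat_size `|a| <= (\sum_(j < n) rat_size (A i j) + rat_size
  (t i 0%R) + rat_size D).+1)%N.
  apply: nat_size_le => //; rewrite expnS mul2n -addnn -addn1;
    apply: leq_add lt_a _.
  by rewrite expn_gt0.
have {}lt_P : (nat_size P <= (\sum_(j < n) rat_size (A i j)).+1)%N.
  apply: nat_size_le => //; rewrite expnS mul2n -addnn -addn1;
    apply: leq_add lt_P _.
  by rewrite expn_gt0.
lia.
Qed.

(** * Covering a cube by boxes *)

(** The index [s] codes a pair: its parity is the sign of the interval, and [j = s./2] is its level.
    The interval has half-length [D / 2^(j+2)], so this factor stretches the doubled interval to
    half-length [D]. *)
Definition cell_scale (s : nat) : rat := 2 ^+ (s./2).+1.

(** The signed midpoint of [1 - 2^-j] and [1 - 2^-(j+1)]. *)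
Definition cell_center (s : nat) : rat :=
  (-1) ^+ s * (1 - 3 / 2 ^+ (s./2).+2).

Lemma cell_scale_gt0 s : 0 < cell_scale s.
Proof. by rewrite exprn_gt0. Qed.

Lemma cell_centerE j (b : bool) :
  cell_center (b + j.*2) = (-1) ^+ b * (1 - 3 / 2 ^+ j.+2).
Proof.
by rewrite /cell_center half_bit_double -signr_odd oddD odd_double addbF oddb.
Qed.

(** Induction on [k]: either [x] already satisfies the bound for [k - 1], or [|x|] lies in the
    outermost interval. *)
Lemma cell_cover k (D x : rat) : `|x| <= D * (1 - 2 ^- k) -> (0 < k)%N ->
  exists2 s, (s < k.*2)%N & cell_scale s * `|x - D * cell_center s| <= D / 2.
Proof.
elim: k => [//|k IH] xk _.
case: (boolP ((0 < k)%N && (`|x| <= D * (1 - 2 ^- k)))) => [/andP[k0 h]|h].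
  by have [s sk hs] := IH h k0; exists s => //; lia.
(* For [k = 0] the left side is [0], so the innermost interval needs no separate treatment. *)
have {IH}h : D * (1 - 2 ^- k) <= `|x|.
  case: k h {IH xk} => [_|k]; first by rewrite expr0 invr1 subrr mulr0.
  by rewrite andTb -ltNge => /ltW.
(* The sign of [x] gives the parity bit of the index; the level is [k]. *)
exists (((x < 0)%R : nat) + k.*2)%N; first by case: (x < 0); lia.
rewrite cell_centerE /cell_scale half_bit_double.
have p0 : (2 ^+ k : rat) != 0 by rewrite expf_neq0.
have pp : 0 < (2 ^+ k : rat) by rewrite exprn_gt0.
move: xk h; rewrite !exprS; set p := 2 ^+ k in p0 pp *.
have -> : D * (1 - (2 * p)^-1) = D - D / p / 2 by field.
have -> : D * (1 - p^-1) = D - D / p by field.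
have -> : D * ((-1) ^+ (x < 0)%R * (1 - 3 / (2 * (2 * p)))) =
   (-1) ^+ (x < 0)%R * (D - 3 / 4 * (D / p)) by field.
move=> h1 h2; rewrite -ler_pdivlMl ?mulr_gt0//.
have -> : (2 * p)^-1 * (D / 2) = D / p / 4 by field.
move: h1 h2; set w := D / p => h1 h2; rewrite ler_norml.
case: (ltP x 0) h1 h2 => x0;
  rewrite ?(ltr0_norm x0) ?(ger0_norm x0) ?expr0 ?expr1; lra.
Qed.

(** Times [D], the sum is the largest absolute value on the doubled interval. With [p = 2^(s./2)] it
    equals [1 - 1/(4p)]. *)
Lemma cell_inside s : `|cell_center s| + (cell_scale s)^-1 <= 1.
Proof.
rewrite /cell_center /cell_scale normrM normrX normrN1 expr1n mul1r !exprS.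
set p := 2 ^+ _; have p1 : 1 <= p by rewrite exprn_ege1.
have -> : 3 / (2 * (2 * p)) = 3 / 4 * p^-1 by field; lra.
have -> : (2 * p)^-1 = p^-1 / 2 by field; lra.
have : p^-1 <= 1 by rewrite invf_le1//; lra.
have : 0 < p^-1 by rewrite invr_gt0; lra.
by move=> h1 h2; rewrite ger0_norm; lra.
Qed.

Lemma rat_size_cell_scale s : (rat_size (cell_scale s) <= s + 5)%N.
Proof. by apply: leq_trans (rat_size_exp2 _) _; lia. Qed.

Lemma rat_size_cell_center s : (rat_size (cell_center s) <= 2 * s + 40)%N.
Proof.
rewrite /cell_center -signr_odd.
apply: (@leq_trans (rat_size (1 - 3 / 2 ^+ (s./2).+2))).
  by case: odd; rewrite ?mulN1r ?rat_size_opp ?mul1r.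
apply: leq_trans (rat_size_sub _ _) _.
have h1 : (rat_size 1 <= 4)%N := rat_size_nat 1.
have h3 : (rat_size 3 <= 6)%N := rat_size_nat 3.
have : (s./2 <= s)%N by rewrite leq_half_double; lia.
have h := leq_trans (rat_size_div _ _) (leq_add h3 (rat_size_exp2 (s./2).+2)).
move=> hs; apply: leq_trans (leq_mul (leqnn 2) (leq_add h1 h)) _; lia.
Qed.

(** * Enumeration of the boxes by an odometer *)

Definition digit (K c i : nat) : nat := ((c %/ K ^ i) %% K)%N.

Lemma digit_lt K c i : (0 < K)%N -> (digit K c i < K)%N.
Proof. by move=> K0; rewrite ltn_mod. Qed.

(** When [c] is incremented, the carry into position [i] is the truth value of [K ^ i %| c.+1]: it
    is 1 exactly when all lower digits of [c] equal [K - 1]. *)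
Lemma digitS K c i : (0 < K)%N ->
  digit K c.+1 i =
    if (K <= digit K c i + (K ^ i %| c.+1))%N then 0%N
    else (digit K c i + (K ^ i %| c.+1))%N.
Proof.
move=> K0; rewrite /digit divnS ?expn_gt0 ?K0//; set b := (_ %| _)%N.
rewrite -modnDmr addnC; have := ltn_pmod (c %/ K ^ i) K0.
set d := (_ %% K)%N => dK; case: leqP => h; last by rewrite modn_small.
have -> : (d + b = K)%N by case: b h; lia.
by rewrite modnn.
Qed.

(** The carry out of position [i] is the carry into position [i.+1], so a program can propagate the
    divisibility bit with one comparison per digit. *)
Lemma carryS K c i : (0 < K)%N ->
  (K ^ i.+1 %| c.+1)%N = (K <= digit K c i + (K ^ i %| c.+1))%N.
Proof.
move=> K0; have := digitS K c i K0; have := digit_lt K c i K0.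
rewrite expnSr; case: (boolP (K ^ i %| c.+1)%N) => [dv|nd] dK; last first.
  rewrite addn0 leqNgt dK /= => _; apply/negbTE; apply: contra nd.
  by apply: dvdn_trans; rewrite dvdn_mulr.
have -> : (K ^ i * K %| c.+1)%N = (K %| c.+1 %/ K ^ i)%N.
  by rewrite -{1}(divnK dv) mulnC dvdn_pmul2r ?expn_gt0 ?K0.
rewrite /dvdn -/(digit K c.+1 i) => ->.
by case: ifP => // _; rewrite addn1.
Qed.

(** Surjectivity of the odometer: a counter running up to [K ^ n] reaches every box. *)
Lemma digit_ex K n (f : nat -> nat) : (forall i, (i < n)%N -> (f i < K)%N) ->
  exists2 c, (c < K ^ n)%N & forall i, (i < n)%N -> digit K c i = f i.
Proof.
elim: n => [|n IH] fK; first by exists 0%N.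
have [i lin|c cK hc] := IH; first by apply: fK; lia.
have fn := fK n (ltnSn n); have K0 : (0 < K)%N by lia.
have Kn m : (0 < K ^ m)%N by rewrite expn_gt0 K0.
exists (f n * K ^ n + c)%N.
  by rewrite expnS; move: cK fn; set p := (K ^ n)%N; nia.
move=> i; rewrite ltnS leq_eqVlt /digit => /predU1P[->|lin].
  by rewrite divnMDl// divn_small// addn0 modn_small.
(* For [i < n] the summand [f n * K ^ n] is a multiple of [K ^ i.+1], so it does not affect digit
   [i]. *)
have -> : (K ^ n = K ^ (n - i.+1) * K * K ^ i)%N.
  by rewrite -expnSr -expnD; congr (_ ^ _)%N; lia.
by rewrite -(hc i lin) /digit !mulnA divnMDl// modnMDl.
Qed.

(** * Boxes as queries to the 2-gap oracle *)

Lemma mx_norm_cV_leP n (v : 'cV[rat]_n) D : 0 <= D ->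
  reflect (forall i, `|v i 0| <= D) (mx_norm v <= D).
Proof.
move=> D0; rewrite mx_normrE; apply: (iffP (bigmax_leP _ _ _ _)) => [[_ h] i|h].
  exact: (h (i, 0)).
by split=> // -[i j] _; rewrite (ord1 j).
Qed.

(** The scaling turns the doubled box into the cube of radius [D] around the new target and the box
    itself into the cube of radius [D / 2], matching the two sides of a 2-gap answer. *)
Definition box_query (I : instance) (d : nat -> nat) : instance :=
  @Instance (cvp_dim I)
    (\matrix_(i, j) (cvp_basis I i j * cell_scale (d i)))
    (\col_i ((cvp_target I i 0 + cvp_radius I * cell_center (d i))
             * cell_scale (d i)))
    (cvp_radius I) (cvp_radius_gt0 I).

Definition unscale {n} (d : nat -> nat) (v : 'cV[rat]_n) : 'cV[rat]_n :=
  \col_i (v i 0 / cell_scale (d i)).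

Lemma in_lattice_box_query (I : instance) d v :
  in_lattice (cvp_basis I) v ->
  in_lattice (cvp_basis (box_query I d)) (\col_i (v i 0 * cell_scale (d i))).
Proof.
case=> x ->; exists x; apply/matrixP => i j; rewrite (ord1 j) !mxE mulr_suml.
by apply: eq_bigr => l _ /=; rewrite !mxE mulrAC.
Qed.

Lemma in_lattice_unscale (I : instance) d v :
  in_lattice (cvp_basis (box_query I d)) v ->
  in_lattice (cvp_basis I) (unscale d v).
Proof.
case=> x ->; exists x; apply/matrixP => i j; rewrite (ord1 j) !mxE mulr_suml.
apply: eq_bigr => l _ /=; rewrite !mxE mulrAC mulrK// unitfE.
by rewrite lt0r_neq0// cell_scale_gt0.
Qed.

(** By the triangle inequality the distance to the target on an axis is at most [D / E + D * |C|],
    which [cell_inside] bounds by [D]. *)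
Lemma box_query_found (R : realType) (alpha beta : R) (I : instance) d v :
  @gap_cvp_answer R alpha (box_query I d) (Some v) ->
  @gap_cvp_answer R beta I (Some (unscale d v)).
Proof.
have D0 := cvp_radius_gt0 I.
move=> [lv /= /(mx_norm_cV_leP _ _ _ (ltW D0)) nv].
split; first exact: in_lattice_unscale.
apply/(mx_norm_cV_leP _ _ _ (ltW D0)) => i.
have := nv i; rewrite !mxE; have E0 := cell_scale_gt0 (d i).
have := cell_inside (d i); move: (cell_scale _) E0 (cell_center _) => E E0 C.
set D := cvp_radius I in D0 *; set w := v i 0; set t := cvp_target I i 0.
move=> hC hw; have -> : w / E - t = (w - (t + D * C) * E) / E + D * C.
  by field; rewrite lt0r_neq0.
apply: le_trans (ler_normD _ _) _;
  rewrite !normrM (gtr0_norm D0) normfV (gtr0_norm E0).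
apply: (@le_trans _ _ (D / E + D * `|C|)).
  by rewrite lerD2r ler_pM2r ?invr_gt0.
by rewrite -mulrDr ger_pMr// addrC.
Qed.

(** Being outside the box is written as the failure, on some axis, of the bound that [cell_cover]
    provides. *)
Definition box_empty (I : instance) (d : nat -> nat) : Prop :=
  forall v, in_lattice (cvp_basis I) v -> exists i : 'I_(cvp_dim I),
    cvp_radius I / 2 < cell_scale (d i) *
      `|v i 0 - cvp_target I i 0 - cvp_radius I * cell_center (d i)|.

(** By contraposition: a lattice vector of the box, once rescaled, would lie within [D / 2] of the
    target of the query. *)
Lemma box_query_none (R : realType) (I : instance) d :
  @gap_cvp_answer R 2 (box_query I d) None -> box_empty I d.
Proof.
move=> /= h v lv; have {}h := h _ (in_lattice_box_query I d v lv).
have D0 := cvp_radius_gt0 I.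
apply: contrapT => /forallNP hn; move: h; apply/negP; rewrite -leNgt.
have -> : 2^-1 * ratr (cvp_radius I) = ratr (cvp_radius I / 2) :> R.
  by rewrite mulrC rmorphM fmorphV /= ratr_nat.
rewrite ler_rat; apply/mx_norm_cV_leP; first by rewrite divr_ge0// ltW.
move=> i; have /negP := hn i; rewrite -leNgt !mxE.
move: (cell_scale _) (cell_scale_gt0 (d i)) (cell_center _) => E E0 C.
by rewrite -[X in X * _](gtr0_norm E0) -normrM; congr (`|_| <= _); ring.
Qed.

(** A lattice vector within [D / (1 + eps)] of the target would lie in some interval on each axis by
    [cell_cover]; [digit_ex] codes these choices by a single [c], whose box would then contain
    it. *)
Lemma all_boxes_empty (R : realType) (eps : R) k (I : instance) :
  0 < eps -> (0 < k)%N -> (1 + eps)^-1 <= 1 - 2 ^- k ->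
  (forall c, (c < k.*2 ^ cvp_dim I)%N -> box_empty I (digit k.*2 c)) ->
  @gap_cvp_answer R (1 + eps) I None.
Proof.
move=> e0 k0 ek he v lv; rewrite ltNge; apply/negP => nv.
have D0 := cvp_radius_gt0 I; set D := cvp_radius I in D0 nv *.
have {}nv : mx_norm (v - cvp_target I) <= D * (1 - 2 ^- k).
  rewrite -(ler_rat R) (le_trans nv)// mulrC !rmorphM rmorphB rmorph1 fmorphV
    rmorphXn /= ratr_nat.
  by rewrite ler_pM2l// ltr0q.
have {}nv : forall i, `|(v - cvp_target I) i 0| <= D * (1 - 2 ^- k).
  apply/mx_norm_cV_leP => //; apply: mulr_ge0; first exact: ltW.
  by rewrite subr_ge0 invf_le1 ?exprn_gt0// exprn_ege1.
have cov (i : 'I_(cvp_dim I)) : exists s, (s < k.*2)%N /\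
    cell_scale s * `|(v - cvp_target I) i 0 - D * cell_center s| <= D / 2.
  by have [s s1 s2] := cell_cover _ _ _ (nv i) k0; exists s.
have [f hf] := choice cov.
(* The choice [f] lives on ordinals and is extended by [0] beyond the dimension. *)
have [i lt_i|c cK hc] := digit_ex k.*2 (cvp_dim I)
    (fun i => if insub i is Some i' then f i' else 0%N).
  by rewrite insubT; have [] := hf (Ordinal lt_i).
have [i] := he c cK v lv; rewrite hc// valK.
have [_] := hf i; rewrite !mxE => h1 h2.
by have := lt_le_trans h2 h1; rewrite ltxx.
Qed.

(** * The number of intervals per axis and the polynomial bounds *)

(** The upper bound on [k] keeps [(2k)^n] within the promised number of calls. For the last bound,
    [2^k >= 2 / eps], and [(1 + eps) (1 - eps / 2) >= 1] because [eps <= 1]. *)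
Lemma cell_count_ex (R : realType) (eps : R) : 0 < eps -> eps <= 1 ->
  exists k, [/\ (1 < k)%N, k%:R <= 2 + log2 (1 / eps) &
    (1 + eps)^-1 <= 1 - 2 ^- k].
Proof.
move=> e0 e1; have l2 : 0 < ln (2 : R) by rewrite ln_gt0// ltr1n.
have ee : 1 / eps = eps^-1 by rewrite div1r.
have z0 : 0 <= log2 (1 / eps).
  by rewrite divr_ge0 ?(ltW l2)// ee ln_ge0// invf_ge1.
exists (Num.truncn (log2 (1 / eps))).+2; have /andP[h1 h2] := truncn_itv z0.
split => //; first by rewrite -addn2 natrD addrC lerD2l.
set k := (Num.truncn _).+2.
have hk : 2 / eps <= 2 ^+ k.
  rewrite exprS ler_pM2l// -ler_ln ?posrE ?invr_gt0 ?exprn_gt0// lnXn//.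
  by move: h2 => /ltW; rewrite ee /log2 ler_pdivrMr// mulr_natl.
have k0 : (0 < k)%N by [].
clearbody k; clear h1 h2 z0 ee l2.
have pk : 0 < (2 ^+ k : R) by rewrite exprn_gt0.
rewrite -lef_pV2 ?posrE ?invr_gt0; last 2 first.
- by rewrite subr_gt0 invf_lt1// exprn_egt1 ?ltr1n// -lt0n.
- by rewrite addr_gt0.
have hv : 2 ^- k <= eps / 2.
  by rewrite -[eps / 2]invrK lef_pV2 ?posrE ?invr_gt0 ?divr_gt0// invf_div.
have q0 : 0 < (2 ^- k : R) by rewrite invr_gt0.
move: (2 ^- k) hv q0 => q hv q0; rewrite invrK -div1r ler_pdivrMr; last by lra.
have : eps * q <= q by rewrite ger_pMl.
by lra.
Qed.

(** The shape of all final bounds: [y] is the encoding size, which dominates the dimension, and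
    [1 + z] dominates [k / 2]. The power of [1 + z] is expanded by the binomial theorem. *)
Lemma poly3_monomial (R : realType) (C : R) (a b : nat) :
  exists d (c : nat -> nat -> nat -> R), forall x y z : R,
    poly3 d c x y z = C * y ^+ a * (1 + z) ^+ b.
Proof.
exists (maxn a b).+1, (fun i j k => if (i == 0%N) && (j == a) then C *
  ('C(b, k))%:R else 0).
move=> x y z; rewrite /poly3 (bigD1 ord0)//= [X in _ + X]big1 ?addr0;
  last first.
  by move=> i; rewrite -val_eqE /= => /negbTE-> ; rewrite big1// => j _;
    rewrite big1// => k _; rewrite !mul0r.
have ha : (a < (maxn a b).+1)%N by rewrite ltnS leq_maxl.
rewrite (bigD1 (Ordinal ha))//= [X in _ + X]big1 ?addr0; last first.
  by move=> i; rewrite -val_eqE /= => /negbTE->; rewrite big1// => j _;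
    rewrite !mul0r.
rewrite eqxx exprDn mulr_sumr.
have hb : (b.+1 <= (maxn a b).+1)%N by rewrite ltnS leq_maxr.
rewrite (big_ord_widen _ (fun k => C * y ^+ a * (1 ^+ (b - k) * z ^+ k *+
  'C(b, k))) hb).
rewrite [RHS]big_mkcond; apply: eq_bigr => k _; case: ltnP => kb.
  by rewrite expr1n mul1r -mulr_natl; ring.
(* The sum is padded beyond degree [b], where the binomial coefficients vanish. *)
by rewrite bin_small//; ring.
Qed.

(** * Programs with bounded running time *)

(** A factor fixed by the syntax: if every cell and constant read has at most [S] bits, the value
    has at most this many times [S] bits. The recursion follows [rat_size_eval_binop]. *)
Fixpoint value_weight (e : expr) : nat :=
  if e is Bin _ e1 e2 then (2 * (value_weight e1 + value_weight e2))%N else 1%N.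

Fixpoint cost_weight (e : expr) : nat :=
  match e with
  | Cst _ => 1
  | Get _ i => (cost_weight i).+1
  | Bin _ e1 e2 => value_weight e + cost_weight e1 + cost_weight e2
  end%N.

Fixpoint reads_small (S : nat) (m : memory) (e : expr) : Prop :=
  match e with
  | Cst q => (rat_size q <= S)%N
  | Get a i => reads_small S m i /\
               (rat_size (m a (Num.truncn (eval m i))) <= S)%N
  | Bin _ e1 e2 => reads_small S m e1 /\ reads_small S m e2
  end.

Lemma rat_size_eval_binop o x y :
  (rat_size (eval_binop o x y) <= 2 * (rat_size x + rat_size y))%N.
Proof.
have := rat_size_ge3 x; have := rat_size_ge3 y.
case: o => /= hx hy; first exact: rat_size_add.
- exact: rat_size_sub.
- by apply: leq_trans (rat_size_mul _ _) _; lia.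
- by apply: leq_trans (rat_size_div _ _) _; lia.
- by case: ifP => _; [apply: leq_trans (rat_size_nat 1) _
                     |apply: leq_trans (rat_size_nat 0) _]; lia.
Qed.

Lemma rat_size_eval S m e : reads_small S m e ->
  (rat_size (eval m e) <= value_weight e * S)%N.
Proof.
elim: e => [q|a i _|o e1 IH1 e2 IH2] /=.
- by rewrite mul1n.
- by case=> _; rewrite mul1n.
- move=> [/IH1 h1 /IH2 h2]; apply: leq_trans (rat_size_eval_binop _ _ _) _.
  by rewrite -mulnA leq_mul2l /= mulnDl leq_add.
Qed.

Lemma eval_cost_le S m e : reads_small S m e ->
  (eval_cost m e <= cost_weight e * S)%N.
Proof.
move=> h; have := rat_size_eval _ _ _ h.
elim: e h => [q|a i IH|o e1 IH1 e2 IH2] /=.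
- by rewrite addn0.
- by case=> h _ hq; rewrite mulSn leq_add ?IH ?rat_size_eval//
    -[X in (_ <= X)%N]mul1n.
- move=> [h1 h2] hq.
  have {}IH1 := IH1 h1 (rat_size_eval _ _ _ h1).
  have {}IH2 := IH2 h2 (rat_size_eval _ _ _ h2).
  by apply: leq_trans (leq_add hq (leq_add IH1 IH2)) _; rewrite -!mulnDl addnA.
Qed.

Lemma update_same m a i q : update m a i q a i = q.
Proof. by rewrite /update !eqxx. Qed.

Lemma update_array m a i q b j : b != a -> update m a i q b j = m b j.
Proof. by rewrite /update => /negbTE->. Qed.

Lemma update_index m a i q b j : j != i -> update m a i q b j = m b j.
Proof. by rewrite /update => /negbTE->; rewrite andbF. Qed.

(* [q] collects the queries made so far, so that the rules for sequences and
   loops need not mention concatenation. *)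
Definition run (O : oracle) (c : cmd) (m : memory) (q : seq instance)
    (B : nat) (Q : memory -> seq instance -> Prop) : Prop :=
  exists m' T qs, [/\ exec O c m m' T qs, (T <= B)%N & Q m' (q ++ qs)].

Lemma run_weaken O c m q B B' (Q Q' : memory -> seq instance -> Prop) :
  (B <= B')%N -> (forall m' q', Q m' q' -> Q' m' q') ->
  run O c m q B Q -> run O c m q B' Q'.
Proof.
move=> BB QQ [m' [T [qs [ex TB h]]]]; exists m', T, qs.
by split=> //; [apply: leq_trans TB BB|apply: QQ].
Qed.

Lemma run_seq O c1 c2 m q B1 B2 Q :
  run O c1 m q B1 (fun m1 q1 => run O c2 m1 q1 B2 Q) ->
  run O (Seq c1 c2) m q (B1 + B2) Q.
Proof.
move=> [m1 [T1 [q1 [e1 h1 [m2 [T2 [q2 [e2 h2 hQ]]]]]]]].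
exists m2, (T1 + T2)%N, (q1 ++ q2); split; rewrite ?leq_add ?catA//.
exact: exec_seq e1 e2.
Qed.

Lemma run_assign O W S m q a i e j x (Q : memory -> seq instance -> Prop) :
  reads_small S m i -> reads_small S m e ->
  (cost_weight i + cost_weight e <= W)%N ->
  eval m i = j%:R -> eval m e = x -> Q (update m a j x) q ->
  run O (Assign a i e) m q (W * S) Q.
Proof.
move=> si se w ei ee hQ.
exists (update m a j x), (eval_cost m i + eval_cost m e)%N, [::].
rewrite cats0; split=> //; first by
  rewrite -(natrK j : Num.truncn (j%:R : rat) = j) -ei -ee; exact: exec_assign.
apply: leq_trans (leq_add (eval_cost_le _ _ _ si) (eval_cost_le _ _ _ se)) _.
by rewrite -mulnDl leq_mul2r w orbT.
Qed.

Lemma run_if O W S e c1 c2 m q B Q :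
  reads_small S m e -> (cost_weight e <= W)%N ->
  (eval m e != 0 -> run O c1 m q B Q) -> (eval m e = 0 -> run O c2 m q B Q) ->
  run O (If e c1 c2) m q (W * S + B) Q.
Proof.
move=> se w h1 h2.
have cost : (eval_cost m e <= W * S)%N.
  by apply: leq_trans (eval_cost_le _ _ _ se) _; rewrite leq_mul2r w orbT.
have [e0|e0] := eqVneq (eval m e) 0.
  have [m' [T [qs [ex TB hQ]]]] := h2 e0.
  exists m', (eval_cost m e + T)%N, qs; split=> //; first exact: exec_if_false.
  by rewrite leq_add.
have [m' [T [qs [ex TB hQ]]]] := h1 e0.
exists m', (eval_cost m e + T)%N, qs; split=> //; first exact: exec_if_true.
by rewrite leq_add.
Qed.

(** [i] counts the completed rounds. A true test forces [i < N], so at most [N - i] rounds remain;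
    the last summand pays for the failing test. The loop may stop early, so [Q] has to follow from
    the invariant at every [i]. *)
Lemma run_while O W S e c N B (Inv : nat -> memory -> seq instance -> Prop)
    (Q : memory -> seq instance -> Prop) :
  (cost_weight e <= W)%N ->
  (forall i m q, (i <= N)%N -> Inv i m q -> reads_small S m e) ->
  (forall i m q, (i <= N)%N -> Inv i m q -> eval m e = 0 -> Q m q) ->
  (forall i m q, (i <= N)%N -> Inv i m q -> eval m e != 0 ->
     (i < N)%N /\ run O c m q B (Inv i.+1)) ->
  forall i m q, (i <= N)%N -> Inv i m q ->
  run O (While e c) m q ((N - i) * (B + W * S) + W * S) Q.
Proof.
move=> w hs hQ hc i m q iN; move Er : (N - i)%N => r.
elim: r i m q iN Er => [|r IH] i m q iN Er hI;
  have cost : (eval_cost m e <= W * S)%N by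
    apply: leq_trans (eval_cost_le _ _ _ (hs i m q iN hI)) _;
      rewrite leq_mul2r w orbT.
  have [e0|e0] := eqVneq (eval m e) 0; last by have [] := hc i m q iN hI e0;
    lia.
  exists m, (eval_cost m e), [::]; rewrite cats0; split=> //;
    last exact: (hQ i).
  exact: exec_while_false.
have [e0|e0] := eqVneq (eval m e) 0.
  exists m, (eval_cost m e), [::]; rewrite cats0; split=> //;
    last exact: (hQ i).
  - exact: exec_while_false.
  - by apply: leq_trans cost _; rewrite leq_addl.
have [lt_iN [m1 [T1 [q1 [e1 TB1 hI1]]]]] := hc i m q iN hI e0.
have Er1 : (N - i.+1 = r)%N by lia.
have [m2 [T2 [q2 [e2 TB2 hQ2]]]] := IH _ _ _ lt_iN Er1 hI1.
exists m2, (eval_cost m e + T1 + T2)%N, (q1 ++ q2); rewrite catA; split=> //.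
  exact: exec_while_true e1 e2.
by rewrite mulSn; lia.
Qed.

Definition var (a : nat) : expr := Get a (Cst 0).
Definition set_var (a : nat) (e : expr) : cmd := Assign a (Cst 0) e.
Definition incr (a : nat) : cmd := set_var a (Bin Add (var a) (Cst 1)).
(** [Leq] is the only comparison, so [a < n] is tested as [a + 1 <= n], with [n] read from the array
    that holds the dimension. *)
Definition for_dim (a : nat) (c : cmd) : cmd :=
  While (Bin Leq (Bin Add (var a) (Cst 1)) (var 0)) c.

Lemma eval_var m a : eval m (var a) = m a 0%N.
Proof. by rewrite /= (natrK 0 : Num.truncn (0 : rat) = 0%N). Qed.

Lemma eval_bin m e1 e2 :
  (eval m (Bin Add e1 e2) = eval m e1 + eval m e2) *
  (eval m (Bin Sub e1 e2) = eval m e1 - eval m e2) *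
  (eval m (Bin Mul e1 e2) = eval m e1 * eval m e2) *
  (eval m (Bin Div e1 e2) = eval m e1 / eval m e2) *
  (eval m (Bin Leq e1 e2) = if eval m e1 <= eval m e2 then 1 else 0).
Proof. by []. Qed.

Lemma eval_cst m q : eval m (Cst q) = q. Proof. by []. Qed.

Lemma eval_get m a e i : eval m e = i%:R -> eval m (Get a e) = m a i.
Proof. by move=> /= ->; rewrite natrK. Qed.

Lemma reads_small_var S m a : (6 <= S)%N -> (rat_size (m a 0%N) <= S)%N ->
  reads_small S m (var a).
Proof.
move=> S6 h; split; last by rewrite -[m a _]/(eval m (var a)) eval_var.
by apply: leq_trans (rat_size_nat 0) _; lia.
Qed.

(* 50 bounds the [cost_weight] of every assignment and test of [search]. *)
Lemma run_set_var O S m q a e x (Q : memory -> seq instance -> Prop) :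
  (6 <= S)%N -> reads_small S m e -> (cost_weight e <= 49)%N ->
  eval m e = x -> Q (update m a 0 x) q ->
  run O (set_var a e) m q (50 * S) Q.
Proof.
move=> S6 se we ee hQ; apply: (@run_assign _ _ _ _ _ _ _ _ 0%N x) => //.
by apply: leq_trans (rat_size_nat 0) _; lia.
Qed.

Lemma run_incr O S m q a i (Q : memory -> seq instance -> Prop) :
  (6 <= S)%N -> m a 0%N = i%:R -> (rat_size (i%:R) <= S)%N ->
  Q (update m a 0 i.+1%:R) q -> run O (incr a) m q (50 * S) Q.
Proof.
move=> S6 mi si hQ; apply: (@run_set_var _ _ _ _ _ _ i.+1%:R) => //.
  split; first by apply: reads_small_var; rewrite ?mi.
  by apply: leq_trans (rat_size_nat 1) _; lia.
by rewrite !eval_bin eval_cst eval_var mi natr1.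
Qed.

Lemma run_for_dim O S n a c B (Inv : nat -> memory -> seq instance -> Prop) m q
  :
  (6 <= S)%N -> (forall i, (i <= n)%N -> (rat_size i%:R <= S)%N) ->
  (forall i m q, (i <= n)%N -> Inv i m q -> m a 0%N = i%:R /\ m 0%N 0%N = n%:R)
    ->
  (forall i m q, (i < n)%N -> Inv i m q -> run O c m q B (Inv i.+1)) ->
  Inv 0%N m q -> run O (for_dim a c) m q (n * (B + 50 * S) + 50 * S) (Inv n).
Proof.
move=> S6 hn hv hc hI; rewrite -{1}(subn0 n).
have ev i m' q' : (i <= n)%N -> Inv i m' q' ->
    eval m' (Bin Leq (Bin Add (var a) (Cst 1)) (var 0)) =
    if (i < n)%N then 1 else 0.
  move=> iN /(hv _ _ _ iN)[ha h0].
  by rewrite !eval_bin eval_cst !eval_var ha h0 natr1 ler_nat.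
apply: (run_while _ _ _ _ _ _ _ Inv) => //.
- move=> i m' q' iN /(hv _ _ _ iN)[ha h0]; split; last first.
    by apply: reads_small_var; rewrite ?h0 ?hn.
  split; first by apply: reads_small_var; rewrite ?ha ?hn.
  by apply: leq_trans (rat_size_nat 1) _; lia.
- move=> i m' q' iN hI'; rewrite (ev _ _ _ iN hI'); case: ltnP => // ni _.
  by have -> : n = i by lia.
- move=> i m' q' iN hI'; rewrite (ev _ _ _ iN hI').
  by case: ltnP => [lt_in _|_]; rewrite ?eqxx//; split=> //; apply: hc.
Qed.

(** * Searching the boxes *)

(* Arrays 6-9 hold the query and 10-11 its answer, 12 and 13 the tables of cell
   scales and centers, 14 the digits of the current box, 15 and 16 the row and
   column counters, 17 the carry, 18 the number of cells per axis, 19 the flag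
   of the main loop and 20 the scales of the rows of the query. *)

Definition cur_digit : expr := Get 14 (var 15).

Definition cur_entry : expr := Bin Add (Bin Mul (var 15) (var 0)) (var 16).

Definition fill_row : cmd :=
  for_dim 16 (Seq
    (Assign 7 cur_entry (Bin Mul (Get 1 cur_entry) (Get 20 (var 15))))
    (incr 16)).

(** One odometer step at the current row. A digit that wraps round to 0 leaves the carry at 1;
    otherwise the carry is absorbed and cleared. *)
Definition next_digit : cmd :=
  If (Bin Leq (var 18) (Bin Add cur_digit (var 17)))
     (Assign 14 (var 15) (Cst 0))
     (Seq (Assign 14 (var 15) (Bin Add cur_digit (var 17)))
          (set_var 17 (Cst 0))).

Definition fill_target : cmd :=
  Assign 8 (var 15)
    (Bin Mul (Bin Add (Get 2 (var 15)) (Bin Mul (var 3) (Get 13 cur_digit)))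
             (Get 20 (var 15))).

(** The scale is saved before the digit advances: when the query is complete, array 14 describes the
    next box, while decoding needs the scales of the present one. *)
Definition do_row : cmd :=
  Seq (Assign 20 (var 15) (Get 12 cur_digit))
 (Seq fill_target
 (Seq (set_var 16 (Cst 0))
 (Seq fill_row
 (Seq next_digit (incr 15))))).

Definition build_query : cmd :=
  Seq (set_var 15 (Cst 0)) (Seq (set_var 17 (Cst 1)) (for_dim 15 do_row)).

Definition decode_answer : cmd :=
  Seq (set_var 15 (Cst 0))
    (for_dim 15 (Seq
      (Assign 5 (var 15) (Bin Div (Get 11 (var 15)) (Get 20 (var 15))))
      (incr 15))).

(** The carry left by the last row is 1 exactly when the odometer overflows, so setting the flag to
    [1 - carry] ends the loop after the last box. *)
Definition try_box : cmd :=
  Seq build_query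
 (Seq (Query 6 10)
      (If (var 10)
          (Seq decode_answer (Seq (set_var 4 (Cst 1)) (set_var 19 (Cst 0))))
          (set_var 19 (Bin Sub (Cst 1) (var 17))))).

Definition search : cmd :=
  Seq (set_var 6 (var 0))
 (Seq (set_var 9 (var 3))
 (Seq (set_var 19 (Cst 1))
      (While (var 19) try_box))).

(** * Correctness and cost of building a query and decoding its answer *)

Lemma reads_small_get S m a e i : reads_small S m e -> eval m e = i%:R ->
  (rat_size (m a i) <= S)%N -> reads_small S m (Get a e).
Proof. by move=> se ee h; split=> //; rewrite ee natrK. Qed.

Lemma bit_small {S : nat} (b : bool) : (6 <= S)%N -> (rat_size b%:R <= S)%N.
Proof. by move=> S6; apply: leq_trans (rat_size_nat b) _; case: b; lia. Qed.

Definition frame (l : seq nat) (m m' : memory) : Prop :=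
  forall a i, a \notin l -> m' a i = m a i.

Lemma frame_update l m m' a i x : a \in l -> frame l m m' ->
  frame l m (update m' a i x).
Proof.
move=> al h b j bl; rewrite update_array ?h//.
by apply: contraNneq bl => ->.
Qed.

Lemma frame_trans l l' m m' m'' : {subset l' <= l} ->
  frame l m m' -> frame l' m' m'' -> frame l m m''.
Proof.
move=> ll h h' a i al; rewrite h' ?h//.
by apply: contra al; apply: ll.
Qed.

Section Search.
Variables (O : oracle) (S n K : nat) (D : rat) (A t : nat -> rat).

(** The part of the memory that the search only reads. *)
Record env (m : memory) : Prop := Env {
  env_dim : m 0%N 0%N = n%:R;
  env_basis : forall p, (p < n * n)%N -> m 1%N p = A p;
  env_target : forall i, (i < n)%N -> m 2%N i = t i;
  env_radius : m 3%N 0%N = D;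
  env_scale : forall s, (s < K)%N -> m 12%N s = cell_scale s;
  env_center : forall s, (s < K)%N -> m 13%N s = cell_center s;
  env_cells : m 18%N 0%N = K%:R }.

Lemma env_frame l m m' : all (fun a => a \notin [:: 0; 1; 2; 3; 12; 13;
  18])%N l ->
  frame l m m' -> env m -> env m'.
Proof.
move=> /allP hl h e.
have f a i : a \in [:: 0; 1; 2; 3; 12; 13; 18]%N -> m' a i = m a i.
  by move=> ha; apply: h; apply/negP => /hl; rewrite ha.
by case: e => *; split=> *; rewrite f// ?inE//; auto.
Qed.

Hypothesis S6 : (6 <= S)%N.
Hypothesis K0 : (0 < K)%N.
Hypothesis nat_small : forall i, (i <= n + K)%N -> (rat_size i%:R <= S)%N.
Hypothesis A_small : forall p, (p < n * n)%N -> (rat_size (A p) <= S)%N.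
Hypothesis t_small : forall i, (i < n)%N -> (rat_size (t i) <= S)%N.
Hypothesis D_small : (rat_size D <= S)%N.
Hypothesis scale_small : forall s, (s < K)%N -> (rat_size (cell_scale s) <=
  S)%N.
Hypothesis center_small : forall s, (s < K)%N -> (rat_size (cell_center s) <=
  S)%N.

Definition scaled_entry (c p : nat) : rat := A p * cell_scale
  (digit K c (p %/ n)).

Definition scaled_target (c i : nat) : rat :=
  (t i + D * cell_center (digit K c i)) * cell_scale (digit K c i).

Let dK c i : (digit K c i < K)%N := digit_lt K c i K0.

Lemma dim_small i : (i <= n)%N -> (rat_size i%:R <= S)%N.
Proof. by move=> h; apply: nat_small; apply: leq_trans h (leq_addr _ _). Qed.

Lemma digit_small c i : (rat_size (digit K c i)%:R <= S)%N.
Proof. by apply: nat_small; have := dK c i; lia. Qed.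

Lemma reads_small_nat m a i : m a 0%N = i%:R -> (i <= n)%N -> reads_small S m
  (var a).
Proof. by move=> h iN; apply: reads_small_var => //; rewrite h dim_small. Qed.

Lemma run_fill_row c i m q : env m -> (i < n)%N -> m 15%N 0%N = i%:R ->
  m 20%N i = cell_scale (digit K c i) -> m 16%N 0%N = 0 ->
  (forall p, (p < i * n)%N -> m 7%N p = scaled_entry c p) ->
  run O fill_row m q (n * (150 * S) + 50 * S) (fun m' q' =>
    [/\ q' = q, frame [:: 7; 16]%N m m' &
        forall p, (p < i * n + n)%N -> m' 7%N p = scaled_entry c p]).
Proof.
move=> em iN m15 m20 m16 m7.
pose Inv j (m' : memory) (q' : seq instance) :=
  [/\ q' = q, frame [:: 7; 16]%N m m', m' 16%N 0%N = j%:R &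
      forall p, (p < i * n + j)%N -> m' 7%N p = scaled_entry c p].
have -> : (150 * S = (50 * S + 50 * S) + 50 * S)%N by lia.
apply: (@run_weaken _ _ _ _ _ _ (Inv n)) (leqnn _) _ _;
  first by move=> m' q' [].
apply: run_for_dim => //; first exact: dim_small.
- move=> j m' q' jn [_ fr -> _]; split=> //; rewrite fr//; exact: env_dim em.
- move=> j m' q' jn [-> fr h16 h7].
  have em' : env m' by apply: env_frame fr em.
  have h15 : m' 15%N 0%N = i%:R by rewrite fr.
  have ee : eval m' cur_entry = (i * n + j)%:R.
    by rewrite !eval_bin !eval_var h15 (env_dim _ em') h16 -natrM -natrD.
  have se : reads_small S m' cur_entry.
    split; [split|].
    - exact: reads_small_nat h15 (ltnW iN).
    - exact: reads_small_nat (env_dim _ em') (leqnn n).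
    - exact: reads_small_nat h16 (ltnW jn).
  have lt_p : (i * n + j < n * n)%N by nia.
  have h1 := env_basis _ em' _ lt_p.
  have e15 : eval m' (var 15) = i%:R by rewrite eval_var.
  have h20 : m' 20%N i = cell_scale (digit K c i) by rewrite fr.
  apply: run_seq; apply: (@run_assign _ _ _ _ _ _ _ _ (i * n + j)%N
    (scaled_entry c (i * n + j))) => //.
  + split; first by apply: reads_small_get se ee _; rewrite h1 A_small.
    apply: (reads_small_get _ _ _ _ i) => //;
      first exact: reads_small_nat h15 (ltnW iN).
    by rewrite h20 scale_small.
  + rewrite eval_bin (eval_get _ _ _ _ ee) (eval_get _ _ _ _ e15) h1 h20.
    by rewrite /scaled_entry divnMDl ?divn_small ?addn0//; lia.
  apply: (run_incr _ _ _ _ _ j) => //.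
  + by apply: dim_small; lia.
  split=> //; first by do 2 apply: frame_update => //.
  + move=> p lt; rewrite update_array//.
    have [->|ne] := eqVneq p (i * n + j)%N; first by rewrite update_same.
    by rewrite update_index// h7//; lia.
- by split=> // p; rewrite addn0; apply: m7.
Qed.

Lemma run_next_digit c i m q : env m -> (i < n)%N -> m 15%N 0%N = i%:R ->
  m 17%N 0%N = (K ^ i %| c.+1)%:R -> m 14%N i = (digit K c i)%:R ->
  run O next_digit m q (150 * S) (fun m' q' =>
    [/\ q' = q, frame [:: 14; 17]%N m m',
        m' 17%N 0%N = (K ^ i.+1 %| c.+1)%:R,
        m' 14%N i = (digit K c.+1 i)%:R &
        forall j, j != i -> m' 14%N j = m 14%N j]).
Proof.
move=> em iN m15 m17 m14.
have e15 : eval m (var 15) = i%:R by rewrite eval_var.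
have s15 := reads_small_nat m 15 i m15 (ltnW iN).
have sd : reads_small S m cur_digit.
  by apply: (reads_small_get _ _ _ _ i) => //; rewrite m14 digit_small.
have s17 : reads_small S m (var 17) by apply: reads_small_var;
  rewrite ?m17 ?bit_small.
have es : eval m (Bin Add cur_digit (var 17)) =
  (digit K c i + (K ^ i %| c.+1))%:R.
  by rewrite eval_bin (eval_get _ _ _ _ e15) eval_var m14 m17 natrD.
have c0 : reads_small S m (Cst 0) := bit_small false S6.
have -> : (150 * S = 50 * S + (50 * S + 50 * S))%N by lia.
apply: run_if => //.
- split; last by split.
  by apply: reads_small_var; rewrite ?(env_cells _ em)// nat_small// leq_addl.
- rewrite eval_bin es eval_var (env_cells _ em) ler_nat -carryS// digitS//
    -carryS//.
  case: ifP => // h _.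
  apply: (@run_weaken _ _ _ _ (50 * S) _ _ _ (leq_addr _ _) (fun _ _ => id)).
  apply: (@run_assign _ _ _ _ _ _ _ _ i 0) => //; split=> //.
  + exact: frame_update.
  (* The carry cell is not written in this branch. Its old value is right: [K ^ i.+1 %| c.+1]
     implies [K ^ i %| c.+1], so both bits are 1. *)
  + rewrite update_array// m17; congr (_ %:R); congr nat_of_bool.
    by apply: dvdn_trans h; rewrite expnS dvdn_mull.
  + by rewrite update_same.
  + by move=> j ji; rewrite update_index.
- rewrite eval_bin es eval_var (env_cells _ em) ler_nat -carryS// digitS//
    -carryS//.
  case: ifP => // h _.
  apply: run_seq; apply: (@run_assign _ _ _ _ _ _ _ _ i
    (digit K c i + (K ^ i %| c.+1))%:R) => //.
  apply: (@run_set_var _ _ _ _ _ _ 0) => //; split=> //.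
  + by do 2 apply: frame_update => //.
  + by rewrite update_array// update_same.
  + by move=> j ji; rewrite update_array// update_index.
Qed.

(** The state after [i] rows: the digits below [i] have moved on to [c.+1], whereas the rows of the
    query and the saved scales belong to box [c]. *)
Definition built (c i : nat) (m : memory) : Prop :=
  [/\ m 17%N 0%N = (K ^ i %| c.+1)%:R,
      forall j, (j < n)%N ->
        m 14%N j = (digit K (if (j < i)%N then c.+1 else c) j)%:R,
      forall j, (j < i)%N -> m 20%N j = cell_scale (digit K c j),
      forall j, (j < i)%N -> m 8%N j = scaled_target c j &
      forall p, (p < i * n)%N -> m 7%N p = scaled_entry c p].

Lemma run_do_row c i m q : env m -> (i < n)%N -> m 15%N 0%N = i%:R -> built c i
  m ->
  run O do_row m q (n * (150 * S) + 400 * S) (fun m' q' =>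
    [/\ q' = q, frame [:: 7; 8; 14; 15; 16; 17;
      20]%N m m', m' 15%N 0%N = i.+1%:R &
        built c i.+1 m']).
Proof.
move=> em iN m15 [m17 m14 m20 m8 m7].
have -> : (n * (150 * S) + 400 * S = 50 * S + (50 * S + (50 * S +
   ((n * (150 * S) + 50 * S) + (150 * S + 50 * S)))))%N by lia.
have h14 : m 14%N i = (digit K c i)%:R by rewrite m14// ltnn.
have e15 : eval m (var 15) = i%:R by rewrite eval_var.
have s15 := reads_small_nat m 15 i m15 (ltnW iN).
have sd : reads_small S m cur_digit.
  by apply: (reads_small_get _ _ _ _ i) => //; rewrite h14 digit_small.
have ed : eval m cur_digit = (digit K c i)%:R by rewrite (eval_get _ _ _ _ e15).
apply: run_seq; apply: (@run_assign _ _ _ _ _ _ _ _ i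
  (cell_scale (digit K c i))) => //.
- by apply: reads_small_get sd ed _; rewrite (env_scale _ em)// scale_small.
- by rewrite (eval_get _ _ _ _ ed) (env_scale _ em).
set m1 := update _ _ _ _.
have f1 : frame [:: 7; 8; 14; 15; 16; 17; 20]%N m m1 by apply: frame_update.
have em1 : env m1 by apply: env_frame f1 em.
have e15' : eval m1 (var 15) = i%:R by rewrite eval_var /m1 update_array.
have s15' : reads_small S m1 (var 15) by apply: (reads_small_nat _ _ i)
  (ltnW iN); rewrite /m1 update_array.
have ed' : eval m1 cur_digit = (digit K c i)%:R.
  by rewrite (eval_get _ _ _ _ e15') /m1 update_array.
have sd' : reads_small S m1 cur_digit.
  by apply: (reads_small_get _ _ _ _ i) => //;
    rewrite /m1 update_array// h14 digit_small.
apply: run_seq; apply: (@run_assign _ _ _ _ _ _ _ _ i (scaled_target c i)) =>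
  //.
- split; [split; [|split]|].
  + by apply: reads_small_get s15' e15' _; rewrite (env_target _ em1)// t_small.
  + by apply: reads_small_var; rewrite ?(env_radius _ em1).
  + by apply: reads_small_get sd' ed' _;
      rewrite (env_center _ em1)// center_small.
  + by apply: reads_small_get s15' e15' _; rewrite /m1 update_same scale_small.
- rewrite !eval_bin !(eval_get _ _ _ _ e15') (eval_get _ _ _ _ ed') eval_var.
  by rewrite (env_target _ em1)// (env_radius _ em1) (env_center _ em1)// /m1
    update_same.
set m2 := update m1 _ _ _.
have f2 : frame [:: 7; 8; 14; 15; 16; 17; 20]%N m m2 by apply: frame_update.
apply: run_seq; apply: (@run_set_var _ _ _ _ _ _ 0) => //.
  exact: (bit_small false S6).
set m3 := update m2 _ _ _.
have f3 : frame [:: 7; 8; 14; 15; 16; 17; 20]%N m m3 by apply: frame_update.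
have em3 : env m3 by apply: env_frame f3 em.
apply: run_seq; apply: run_weaken (leqnn _) _ (run_fill_row c i m3 q em3 iN _ _
  _ _); first last.
- by move=> p lt; rewrite /m3 /m2 /m1 !update_array// m7.
- by rewrite /m3 update_same.
- by rewrite /m3 /m2 !update_array// /m1 update_same.
- by rewrite /m3 /m2 /m1 !update_array.
move=> m4 q4 [-> f34 m47].
have f4 : frame [:: 7; 8; 14; 15; 16; 17; 20]%N m m4.
  by apply: frame_trans f3 f34 => a; rewrite !inE => /orP[]/eqP->.
have em4 : env m4 by apply: env_frame f4 em.
apply: run_seq; apply: run_weaken (leqnn _) _ (run_next_digit c i m4 q em4 iN _
  _ _); first last.
- by rewrite f34// /m3 /m2 /m1 !update_array.
- by rewrite f34// /m3 /m2 /m1 !update_array.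
- by rewrite f34// /m3 /m2 /m1 !update_array.
move=> m5 q5 [-> f45 m5c m5d m5o].
have f5 : frame [:: 7; 8; 14; 15; 16; 17; 20]%N m m5.
  by apply: frame_trans f4 f45 => a; rewrite !inE => /orP[]/eqP->.
apply: (run_incr _ _ _ _ _ i) => //.
- by rewrite f45// f34// /m3 /m2 /m1 !update_array.
- by apply: dim_small; lia.
split=> //; first exact: frame_update.
split.
- by rewrite update_array.
- move=> j jn; rewrite update_array//; have [->|ne] := eqVneq j i;
    first by rewrite ltnSn.
  rewrite m5o// f34// /m3 /m2 /m1 !update_array// m14//.
  by congr (digit K _ j)%:R; rewrite ltnS [in RHS]leq_eqVlt (negbTE ne).
- move=> j ji; rewrite update_array// f45// f34// /m3 /m2 !update_array// /m1.
  have [->|ne] := eqVneq j i; first by rewrite update_same.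
  by rewrite update_index// m20//; lia.
- move=> j ji; rewrite update_array// f45// f34// /m3 update_array// /m2.
  have [->|ne] := eqVneq j i; first by rewrite update_same.
  by rewrite update_index// /m1 update_array// m8//; lia.
- by move=> p lt; rewrite update_array// f45// m47//; move: lt;
    rewrite mulSn addnC.
Qed.

(** The initial carry 1 is the increment of the odometer; it agrees with the divisibility bit at row
    0 because [K ^ 0] divides [c.+1]. *)
Lemma run_build_query c m q : env m ->
  (forall j, (j < n)%N -> m 14%N j = (digit K c j)%:R) ->
  run O build_query m q (n * (n * (150 * S) + 450 * S) + 150 * S) (fun m' q' =>
    [/\ q' = q, frame [:: 7; 8; 14; 15; 16; 17; 20]%N m m' & built c n m']).
Proof.
move=> em m14.
have -> : (n * (n * (150 * S) + 450 * S) + 150 * S = 50 * S + (50 * S +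
   (n * ((n * (150 * S) + 400 * S) + 50 * S) + 50 * S)))%N by lia.
apply: run_seq; apply: (@run_set_var _ _ _ _ _ _ 0) => //;
  first exact: (bit_small false S6).
apply: run_seq; apply: (@run_set_var _ _ _ _ _ _ 1) => //;
  first exact: (bit_small true S6).
set m1 := update _ _ _ _.
have f1 : frame [:: 7; 8; 14; 15; 16; 17;
  20]%N m m1 by do 2 apply: frame_update => //.
pose Inv i (m' : memory) (q' : seq instance) :=
  [/\ q' = q, frame [:: 7; 8; 14; 15; 16; 17; 20]%N m m', m' 15%N 0%N = i%:R &
      built c i m'].
apply: (@run_weaken _ _ _ _ _ _ (Inv n)) (leqnn _) _ _;
  first by move=> m' q' [].
apply: run_for_dim => //; first exact: dim_small.
- by move=> i m' q' iN [_ fr h15 _]; split=> //; rewrite fr// (env_dim _ em).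
- move=> i m' q' iN [-> fr h15 hb].
  have em' : env m' by apply: env_frame fr em.
  apply: run_weaken (leqnn _) _ (run_do_row c i m' q em' iN h15 hb).
  move=> m2 q2 [-> f2 h2 b2]; split=> //.
  by apply: frame_trans fr f2.
- by split=> //; split=> //; rewrite /m1 update_same expn0 dvd1n.
Qed.

Lemma run_decode (f : nat -> rat) c m q : env m ->
  (forall i, (i < n)%N -> m 11%N i = f i) ->
  (forall i, (i < n)%N -> (rat_size (f i) <= S)%N) ->
  (forall i, (i < n)%N -> m 20%N i = cell_scale (digit K c i)) ->
  run O decode_answer m q (n * (150 * S) + 100 * S) (fun m' q' =>
    [/\ q' = q, frame [:: 5; 15]%N m m' &
        forall i, (i < n)%N -> m' 5%N i = f i / cell_scale (digit K c i)]).
Proof.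
move=> em m11 fS m20.
have -> : (n * (150 * S) + 100 * S = 50 * S + (n * ((50 * S + 50 * S) + 50 * S)
  + 50 * S))%N by lia.
apply: run_seq; apply: (@run_set_var _ _ _ _ _ _ 0) => //;
  first exact: (bit_small false S6).
pose Inv i (m' : memory) (q' : seq instance) :=
  [/\ q' = q, frame [:: 5; 15]%N m m', m' 15%N 0%N = i%:R &
      forall j, (j < i)%N -> m' 5%N j = f j / cell_scale (digit K c j)].
apply: (@run_weaken _ _ _ _ _ _ (Inv n)) (leqnn _) _ _;
  first by move=> m' q' [].
apply: run_for_dim => //; first exact: dim_small.
- by move=> i m' q' iN [_ fr h15 _]; split=> //; rewrite fr// (env_dim _ em).
- move=> i m' q' iN [-> fr h15 h5].
  have e15 : eval m' (var 15) = i%:R by rewrite eval_var.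
  have s15 := reads_small_nat m' 15 i h15 (ltnW iN).
  apply: run_seq; apply: (@run_assign _ _ _ _ _ _ _ _ i
    (f i / cell_scale (digit K c i))) => //.
  + by split; apply: reads_small_get s15 e15 _;
      rewrite fr// ?m11 ?fS// m20 ?scale_small.
  + by rewrite !eval_bin !(eval_get _ _ _ _ e15) !fr// m11// m20.
  apply: (run_incr _ _ _ _ _ i) => //.
  + by apply: dim_small; lia.
  split=> //; first by do 2 apply: frame_update => //.
  + move=> j ji; rewrite update_array//; have [->|ne] := eqVneq j i;
      first by rewrite update_same.
    by rewrite update_index// h5//; lia.
- by split=> //; apply: frame_update.
Qed.

End Search.

(** * Bit length of the queries *)

Lemma instance_size_ge (I : instance) : (cvp_dim I + 3 <= instance_size I)%N.
Proof.
rewrite /instance_size; have := rat_size_ge3 (cvp_radius I);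
  set s := (\sum_(i < _) _)%N.
by set s' := (\sum_(i < _) _)%N; lia.
Qed.

Lemma rat_size_radius (I : instance) :
  (cvp_dim I + rat_size (cvp_radius I) <= instance_size I)%N.
Proof. by rewrite /instance_size leq_add2r -addnA leq_addr. Qed.

Lemma rat_size_row (I : instance) i :
  (\sum_j rat_size (cvp_basis I i j) + rat_size (cvp_target I i 0%R)
   + rat_size (cvp_radius I) <= instance_size I)%N.
Proof.
rewrite /instance_size leq_add2r; apply: leq_add.
  by rewrite [X in (_ <= _ + X)%N](bigD1 i)//= addnCA leq_addr.
by rewrite (bigD1 i)//= leq_addr.
Qed.

Lemma rat_size_basis (I : instance) i j :
  (rat_size (cvp_basis I i j) <= instance_size I)%N.
Proof.
apply: leq_trans (rat_size_row I i); rewrite -addnA (bigD1 j)//= -addnA.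
exact: leq_addr.
Qed.

Lemma rat_size_target (I : instance) i :
  (rat_size (cvp_target I i 0%R) <= instance_size I)%N.
Proof. by apply: leq_trans (rat_size_row I i); rewrite addnAC leq_addl. Qed.

Lemma box_query_size (I : instance) k d : (1 < k)%N ->
  (forall i, d i < k.*2)%N ->
  (instance_size (box_query I d) <= 21 * instance_size I ^ 3 * k)%N.
Proof.
move=> k1 dk; set s := instance_size I; have s3 := instance_size_ge I.
(* The target entries are the largest: [2 (s + s + 4k + 40)] bits for the shifted coordinate and
   [2k + 5] for the scale. *)
pose X := (4 * s + 10 * k + 85)%N.
have hX : (X <= 21 * s * k)%N by rewrite /X; nia.
have hA i j : (rat_size (cvp_basis (box_query I d) i j) <= X)%N.
  rewrite mxE; apply: leq_trans (rat_size_mul _ _) _.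
  apply: leq_trans (leq_add (rat_size_basis I i j) (rat_size_cell_scale (d i)))
    _.
  by have := dk i; rewrite /X -/s; lia.
have ht i : (rat_size (cvp_target (box_query I d) i 0%R) <= X)%N.
  rewrite mxE; apply: leq_trans (rat_size_mul _ _) _.
  apply: leq_trans (leq_add (rat_size_add _ _) (leqnn _)) _.
  have hD := leq_trans (rat_size_mul (cvp_radius I) (cell_center (d i)))
    (leq_add (leq_trans (leq_addl _ _) (rat_size_radius I))
      (rat_size_cell_center (d i))).
  apply: leq_trans (leq_add (leq_mul (leqnn 2) (leq_add (rat_size_target I i)
    hD))
    (rat_size_cell_scale (d i))) _.
  by have := dk i; rewrite /X -/s; lia.
have sA : (\sum_i \sum_j rat_size (cvp_basis (box_query I d) i j) <= cvp_dim I *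
  (cvp_dim I * X))%N.
  apply: (@leq_trans (\sum_(i < cvp_dim I) (cvp_dim I * X))%N);
    last by rewrite sum_nat_const card_ord.
  apply: leq_sum => i _; apply: (@leq_trans (\sum_(j < cvp_dim I) X)%N);
    last by rewrite sum_nat_const card_ord.
  exact: leq_sum.
have st : (\sum_i rat_size (cvp_target (box_query I d) i 0%R) <= cvp_dim I *
  X)%N.
  apply: (@leq_trans (\sum_(i < cvp_dim I) X)%N);
    last by rewrite sum_nat_const card_ord.
  exact: leq_sum.
have hD := rat_size_radius I.
have -> : (21 * s ^ 3 * k = s * s * (21 * s * k))%N by rewrite !expnS expn0;
  lia.
apply: (@leq_trans (s * s * X)%N); last by rewrite leq_mul2l hX orbT.
rewrite /instance_size; move: sA st hD s3.
rewrite -/s -[cvp_dim (box_query I d)]/(cvp_dim I)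
  -[cvp_radius (box_query I d)]/(cvp_radius I).
set sA := (\sum_(i < _) _)%N; set st := (\sum_(i < _) _)%N;
  move: sA st => sA st.
have : (s <= X)%N by rewrite /X; lia.
clear hX hA ht; clearbody X s.
move: (rat_size _) (cvp_dim I) => r n sX hA ht hD s3.
(* One [X] for each matrix and target entry, and one more for the dimension and the radius together;
   [n + 3 <= s] then gives the factor [s * s]. *)
apply: (@leq_trans ((n * n + n + 1) * X)%N); first by lia.
by rewrite leq_mul2r; apply/orP; right; nia.
Qed.

Lemma run_query O a b m q J Q : holds_instance m a J ->
  Q (write_answer m b (O J)) (q ++ [:: J]) ->
  run O (Query a b) m q (instance_size J) Q.
Proof.
move=> hJ hQ; exists (write_answer m b (O J)), (instance_size J), [:: J].
by split=> //; apply: exec_query.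
Qed.

Lemma write_answer_frame m a n (ans : option 'cV[rat]_n) :
  frame [:: a; a.+1] m (write_answer m a ans).
Proof.
move=> b j; rewrite !inE negb_or => /andP[ba ba1]; case: ans => [v|] /=.
  by rewrite (negbTE ba1) update_array.
by rewrite update_array.
Qed.

(** * The search loop *)

Section Main.
Variables (R : realType) (eps : R) (k : nat) (I : instance) (m0 : memory).
Variables (O : oracle) (S M : nat).

Let n := cvp_dim I.
Let K := k.*2.
Let D := cvp_radius I.
Let A := m0 1%N.
Let t := m0 2%N.

Hypothesis eps_gt0 : 0 < eps.
Hypothesis k0 : (0 < k)%N.
Hypothesis eps_k : (1 + eps)^-1 <= 1 - 2 ^- k.
Hypothesis O_solves : solves_gap_cvp (2 : R) O.
Hypothesis m0_basis : forall i j : 'I_n, A (i * n + j)%N = cvp_basis I i j.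
Hypothesis m0_target : forall i : 'I_n, t i = cvp_target I i 0.
Hypothesis S6 : (6 <= S)%N.
Hypothesis nat_small : forall i, (i <= n + K)%N -> (rat_size i%:R <= S)%N.
Hypothesis A_small : forall p, (p < n * n)%N -> (rat_size (A p) <= S)%N.
Hypothesis t_small : forall i, (i < n)%N -> (rat_size (t i) <= S)%N.
Hypothesis D_small : (rat_size D <= S)%N.
Hypothesis scale_small : forall s, (s < K)%N -> (rat_size (cell_scale s) <=
  S)%N.
Hypothesis center_small : forall s, (s < K)%N -> (rat_size (cell_center s) <=
  S)%N.
Hypothesis query_small : forall c,
  (instance_size (box_query I (digit K c)) <= M)%N.
Hypothesis MS : (2 * M + 4 <= S)%N.

Let K0 : (0 < K)%N. Proof. by rewrite double_gt0. Qed.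

(** After [c] rounds, and as many queries, either the first [c] boxes are empty and the loop goes
    on, or the flag is 0 and a correct answer is stored. In the first case array 4 still holds 0,
    which already encodes the answer [None]. *)
Definition search_inv (c : nat) (m : memory) (q : seq instance) : Prop :=
  [/\ env n K D A t m /\ (m 6%N 0%N = n%:R /\ m 9%N 0%N = D),
      forall j, (j < n)%N -> m 14%N j = (digit K c j)%:R,
      size q = c,
      forall J, List.In J q -> (instance_size J <= M)%N &
      [/\ m 19%N 0%N = 1, (c < K ^ n)%N, m 4%N 0%N = 0 &
          forall c', (c' < c)%N -> box_empty I (digit K c')]
      \/ (m 19%N 0%N = 0 /\ exists ans : option 'cV[rat]_n,
            outputs m ans /\ gap_cvp_answer (1 + eps) ans)].

(** [lattice_coord_size], applied to the query itself, gives at most [2 (M + 2)] bits. *)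
Lemma query_answer_small c v i : O (box_query I (digit K c)) = Some v ->
  (rat_size (v i 0%R) <= S)%N.
Proof.
move=> eO; have := O_solves (box_query I (digit K c)); rewrite eO => -[lv].
move=> /(mx_norm_cV_leP _ _ _ (ltW (cvp_radius_gt0 _))) /(_ i).
rewrite mxE [X in _ + X]mxE => nv.
apply: leq_trans (lattice_coord_size _ _ _ _ _ i lv nv) _.
apply: leq_trans MS; rewrite mulnDr; apply: leq_add => //; rewrite leq_mul2l.
exact: leq_trans (rat_size_row (box_query I (digit K c)) i) (query_small c).
Qed.

Lemma built_holds c m : env n K D A t m -> m 6%N 0%N = n%:R -> m 9%N 0%N = D ->
  built n K D A t c n m -> holds_instance m 6 (box_query I (digit K c)).
Proof.
move=> em m6 m9 [_ _ _ m8 m7]; split=> //.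
- move=> i j; rewrite m7; last by have := ltn_ord i; have := ltn_ord j;
    rewrite /= -/n; nia.
  rewrite mxE /scaled_entry m0_basis divnMDl; last by have := ltn_ord i;
    rewrite /= -/n; lia.
  by rewrite divn_small ?addn0.
- by move=> i; rewrite m8// mxE /scaled_target m0_target.
Qed.

(** The summands follow [try_box]: building, the oracle call, the test, and the costlier branch, in
    which a vector is found. *)
Definition box_time : nat :=
  (n * (n * (150 * S) + 450 * S) + 150 * S +
   (M + (50 * S + ((n * (150 * S) + 100 * S) + (50 * S + 50 * S)))))%N.

Lemma run_try_box c m q : search_inv c m q -> m 19%N 0%N != 0 ->
  run O try_box m q box_time (search_inv c.+1).
Proof.
move=> [[em [m6 m9]] m14 sq hq [[m19 cK m4 he]|[-> _]]]; last by rewrite eqxx.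
move=> _; apply: run_seq.
apply: run_weaken (leqnn _) _ (run_build_query O S n K D A t S6 K0 nat_small
  A_small
  t_small D_small scale_small center_small c m q em m14).
move=> m1 q1 [-> f1 b1].
have em1 : env n K D A t m1 by apply: env_frame f1 em.
have hJ : holds_instance m1 6 (box_query I (digit K c)).
  by apply: built_holds b1; rewrite // f1.
set J := box_query I (digit K c) in hJ *.
apply: run_seq; apply: (@run_weaken _ _ _ _ (instance_size J) _ _ _
  (query_small c) (fun _ _ => id)).
apply: run_query hJ _.
case: b1 => b17 b14 b20 _ _.
have hq' J' : List.In J' (q ++ [:: J]) -> (instance_size J' <= M)%N.
  by move=> h; have [/hq//|[<-|//]] := @List.in_app_or _ _ _ _ h;
    apply: query_small.
have sq' : size (q ++ [:: J]) = c.+1 by rewrite size_cat sq addn1.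
have b14' j : (j < n)%N -> m1 14%N j = (digit K c.+1 j)%:R by move=> jn;
  rewrite b14// jn.
have := O_solves J; have := query_answer_small c; rewrite -/J.
set ans := O J => small gap; set m2 := write_answer _ _ _.
have f2 : frame [:: 10; 11]%N m1 m2 by apply: write_answer_frame.
have em2 : env n K D A t m2 by apply: env_frame f2 em1.
have m2_10 : m2 10%N 0%N = (isSome ans)%:R by rewrite /m2; case: (ans).
apply: run_if => //.
- by apply: reads_small_var; rewrite ?m2_10// bit_small.
- rewrite eval_var m2_10; case ea : ans => [v|]; last by rewrite eqxx.
  move=> _; apply: run_seq.
  pose f j := if insub j is Some i then v i 0 else 0.
  have fE (i : 'I_n) : f i = v i 0 by rewrite /f valK.
  have m2_11 j : (j < n)%N -> m2 11%N j = f j.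
    by move=> jn; rewrite /m2 ea /= /f insubT.
  have fS j : (j < n)%N -> (rat_size (f j) <= S)%N.
    by move=> jn; rewrite (fE (Ordinal jn)); apply: small.
  have m2_20 j : (j < n)%N -> m2 20%N j = cell_scale (digit K c j).
    by move=> jn; rewrite f2// b20.
  apply: run_weaken (leqnn _) _ (run_decode O S n K D A t S6 K0 nat_small
    D_small scale_small f c m2
    _ em2 m2_11 fS m2_20).
  move=> m3 q3 [-> f3 m3_5].
  apply: run_seq; apply: (@run_set_var _ _ _ _ _ _ 1) => //;
    first exact: (bit_small true S6).
  apply: (@run_set_var _ _ _ _ _ _ 0) => //; first exact: (bit_small false S6).
  set m4' := update _ _ _ _.
  have f4 : frame [:: 4; 5; 10; 11; 15; 19]%N m1 m4'.
    apply: frame_update => //; apply: frame_update => //.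
    apply: (@frame_trans _ [:: 5; 15]%N _ m2) => //.
      by move=> a; rewrite !inE => /orP[]/eqP->.
    by apply: (@frame_trans _ [:: 10; 11]%N _ m1) => // a;
      rewrite !inE => /orP[]/eqP->.
  split=> //.
  + split; first by apply: env_frame f4 em1.
    by split; rewrite f4// f1.
  + by move=> j jn; rewrite f4// b14'.
  + right; split; first by [].
    exists (Some (unscale (digit K c) v)); split; last first.
      by apply: (@box_query_found _ 2); rewrite -ea.
    split=> // i; rewrite /m4' !update_array// m3_5// mxE fE.
    done.
- rewrite eval_var m2_10; case ea : ans => [v|]; first by move/eqP;
    rewrite oner_eq0.
  move=> _; apply: (@run_weaken _ _ _ _ (50 * S) _ (search_inv c.+1) _ _
    (fun _ _ => id)); first by lia.
  have m2_17 : m2 17%N 0%N = (K ^ n %| c.+1)%:R by rewrite f2.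
  apply: (@run_set_var _ _ _ _ _ _ (~~ (K ^ n %| c.+1)%N)%:R) => //.
  + split; first exact: (bit_small true S6).
    by apply: reads_small_var; rewrite ?m2_17// bit_small.
  + by rewrite eval_bin eval_cst eval_var m2_17; case: (_ %| _)%N;
      rewrite ?subrr ?subr0.
  set m3 := update _ _ _ _.
  have f3 : frame [:: 10; 11; 19]%N m1 m3.
    apply: frame_update => //.
    by apply: (@frame_trans _ [:: 10; 11]%N _ m1) => // a;
      rewrite !inE => /orP[]/eqP->.
  have he' c' : (c' < c.+1)%N -> box_empty I (digit K c').
    rewrite ltnS leq_eqVlt => /predU1P[->|]; last exact: he.
    by apply: (@box_query_none R); rewrite -/J -ea.
  split=> //.
  + split; first by apply: env_frame f3 em1.
    by split; rewrite f3// f1.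
  + by move=> j jn; rewrite f3// b14'.
  + have m3_4 : m3 4%N 0%N = 0 by rewrite f3// f1.
    have m3_19 : m3 19%N 0%N = (~~ (K ^ n %| c.+1)%N)%:R by rewrite /m3
      update_same.
    (* Since [c < K ^ n], divisibility means that all boxes have been tried and found empty;
       otherwise [c.+1 < K ^ n] and the search continues. *)
    case: (boolP (K ^ n %| c.+1)%N) m3_19 => [dv|nd] m3_19; last first.
      left; split=> //; rewrite ltn_neqAle cK andbT.
      by apply: contraNneq nd => ->.
    right; split=> //; exists None; split=> //.
    apply: (all_boxes_empty R eps k) => // c' hc'; apply: he'.
    by apply: leq_trans hc' _; apply: dvdn_leq.
Qed.

Lemma run_search m q : env n K D A t m -> q = [::] -> m 4%N 0%N = 0 ->
  (forall j, m 14%N j = 0) ->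
  run O search m q (K ^ n * (box_time + 50 * S) + 200 * S)
   (fun m' q' => [/\ (size q' <= K ^ n)%N,
      forall J, List.In J q' -> (instance_size J <= M)%N &
      exists ans : option 'cV[rat]_n,
        outputs m' ans /\ gap_cvp_answer (1 + eps) ans]).
Proof.
move=> em -> m4 m14.
have -> : (K ^ n * (box_time + 50 * S) + 200 * S = 50 * S + (50 * S + (50 * S +
   (K ^ n * (box_time + 50 * S) + 50 * S))))%N by lia.
apply: run_seq; apply: (@run_set_var _ _ _ _ _ _ n%:R) => //.
- by apply: reads_small_var;
    rewrite ?(env_dim _ _ _ _ _ _ em)// nat_small// leq_addr.
- by rewrite eval_var (env_dim _ _ _ _ _ _ em).
apply: run_seq; apply: (@run_set_var _ _ _ _ _ _ D) => //.
- by apply: reads_small_var;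
    rewrite ?update_array// ?(env_radius _ _ _ _ _ _ em).
- by rewrite eval_var ?update_array// (env_radius _ _ _ _ _ _ em).
apply: run_seq; apply: (@run_set_var _ _ _ _ _ _ 1) => //;
  first exact: (bit_small true S6).
set m1 := update _ _ _ _.
have f1 : frame [:: 6; 9; 19]%N m m1 by do 3 apply: frame_update => //.
have inv0 : search_inv 0 m1 [::].
  split=> //; first by split=> //; apply: env_frame f1 em.
  (* The zeros in array 14 are the digits of box 0. *)
  - by move=> j jn; rewrite f1// m14 /digit div0n mod0n.
  - by left; split=> //; rewrite expn_gt0 K0.
rewrite -{1}(subn0 (K ^ n)%N).
apply: (run_while _ _ _ _ _ _ _ search_inv) => //.
- move=> c m' q' cN [_ _ _ _ h]; apply: reads_small_var => //.
  by case: h => [[-> _ _ _]|[-> _]];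
    [exact: (bit_small true S6)|exact: (bit_small false S6)].
- move=> c m' q' cN [_ _ sq hq h] e0; rewrite eval_var in e0; split=> //;
    first by rewrite sq.
  by case: h => [[]|[]//]; rewrite e0 => /esym/eqP; rewrite oner_eq0.
- move=> c m' q' cN hI e0; rewrite eval_var in e0; split;
    last exact: run_try_box.
  by case: hI => _ _ _ _ [[]//|[h]]; rewrite h eqxx in e0.
Qed.

End Main.

(** * Constant tables and the total running time *)

(** The recursion unfolds into straight-line code with hard-wired constants, so the resulting
    program depends on [eps] through [k] alone. *)
Fixpoint write_table (a : nat) (f : nat -> rat) (s : nat) (c : cmd) : cmd :=
  if s is s'.+1 then
    Seq (Assign a (Cst s'%:R) (Cst (f s'))) (write_table a f s' c)
  else c.

Lemma run_write_table O S a f s c m q B Q :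
  (forall j, (j < s)%N -> (rat_size j%:R <= S)%N) ->
  (forall j, (j < s)%N -> (rat_size (f j) <= S)%N) ->
  (forall m', frame [:: a] m m' ->
     (forall j, m' a j = if (j < s)%N then f j else m a j) ->
     run O c m' q B Q) ->
  run O (write_table a f s c) m q (s * (2 * S) + B) Q.
Proof.
elim: s m => [|s IH] m sS fS hc; first by rewrite mul0n; apply: hc.
rewrite mulSn -addnA; apply: run_seq.
apply: (@run_assign _ _ _ _ _ _ _ _ s (f s)) => //; [exact: sS|exact: fS|].
apply: IH => [j js|j js|m' fr hm']; [by apply: sS; lia|by apply: fS; lia|].
apply: hc => [b j bl|j].
  by rewrite fr// update_array//; move: bl; rewrite inE.
rewrite hm'; have [->|ne] := eqVneq j s;
  first by rewrite ltnn update_same ltnSn.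
by rewrite update_index// ltnS [in RHS]leq_eqVlt (negbTE ne).
Qed.

Definition gap_program (k : nat) : cmd :=
  write_table 12 cell_scale k.*2
    (write_table 13 cell_center k.*2
      (Seq (set_var 18 (Cst k.*2%:R)) search)).

Lemma run_gap_program (R : realType) (eps : R) k O I m :
  0 < eps -> (1 < k)%N -> (1 + eps)^-1 <= 1 - 2 ^- k ->
  solves_gap_cvp (2 : R) O -> initial m I ->
  let s := instance_size I in
  run O (gap_program k) m [::]
    (200 * s ^ 2 * k * (50 * s ^ 3 * k) * k.*2 ^ cvp_dim I)
    (fun m' qs =>
      [/\ (size qs <= k.*2 ^ cvp_dim I)%N,
          forall J, List.In J qs -> (instance_size J <= 21 * s ^ 3 * k)%N &
          exists ans : option 'cV[rat]_(cvp_dim I),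
            outputs m' ans /\ gap_cvp_answer (1 + eps) ans]).
Proof.
move=> e0 k1 ek Os [[m_dim m_basis m_target m_radius] m_zero] s.
set n := cvp_dim I; set K := k.*2; pose M := (21 * s ^ 3 * k)%N.
(* One bit bound for all numbers read. The oracle answers dictate it through [2 * M + 4], that is
   [42 s^3 k + 4]; the other numbers have size linear in [s] and [k]. *)
set S := (50 * s ^ 3 * k)%N.
have s3 : (n + 3 <= s)%N := instance_size_ge I.
have hs : (9 * s <= s ^ 3)%N by rewrite !expnS expn0; nia.
have sS : (450 * s * k <= S)%N by rewrite /S; nia.
have S6 : (6 <= S)%N by nia.
have skS : (100 * s + 100 * k <= S)%N by nia.
have MS : (2 * M + 4 <= S)%N by rewrite /M /S; nia.
have nat_small i : (i <= n + K)%N -> (rat_size i%:R <= S)%N.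
  by move=> h; apply: leq_trans (rat_size_nat i) _; rewrite /K in h; lia.
have A_small p : (p < n * n)%N -> (rat_size (m 1%N p) <= S)%N.
  move=> pn; have n0 : (0 < n)%N by case: (n) pn; lia.
  have p1 : (p %/ n < n)%N by rewrite ltn_divLR.
  have p2 : (p %% n < n)%N by rewrite ltn_mod.
  rewrite (divn_eq p n) (m_basis (Ordinal p1) (Ordinal p2)).
  by apply: leq_trans (rat_size_basis _ _ _) _; rewrite -/s; lia.
have t_small i : (i < n)%N -> (rat_size (m 2%N i) <= S)%N.
  move=> lt_in; rewrite (m_target (Ordinal lt_in)).
  by apply: leq_trans (rat_size_target _ _) _; rewrite -/s; lia.
have D_small : (rat_size (cvp_radius I) <= S)%N.
  by apply: leq_trans (leq_trans (leq_addl _ _) (rat_size_radius I)) _;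
    rewrite -/s; lia.
have scale_small i : (i < K)%N -> (rat_size (cell_scale i) <= S)%N.
  by move=> h; apply: leq_trans (rat_size_cell_scale i) _; rewrite /K in h; lia.
have center_small i : (i < K)%N -> (rat_size (cell_center i) <= S)%N.
  by move=> h; apply: leq_trans (rat_size_cell_center i) _; rewrite /K in h;
    lia.
have idx_small j : (j < K)%N -> (rat_size j%:R <= S)%N.
  by move=> h; apply: nat_small; lia.
pose B := (K * (2 * S) +
  (K * (2 * S) + (50 * S + (K ^ n * (box_time I S M + 50 * S) + 200 * S))))%N.
apply: (@run_weaken _ _ _ _ B _ _ _ _ (fun _ _ => id)).
  have K1 : (0 < K ^ n)%N by rewrite expn_gt0 /K; lia.
  have hM : (M <= S)%N by lia.
  (* The factor [150 n^2 + 600 n + 451] is at most [150 (n + 3)^2], and [n + 3 <= s]. *)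
  have hbox : (box_time I S M + 50 * S <= 150 * s ^ 2 * S)%N.
    rewrite /box_time -/n !expnS expn0; clear -s3 hM; clearbody s S M n.
    apply: (@leq_trans ((150 * (n * n) + 600 * n + 451) * S)%N); first by lia.
    by rewrite leq_mul2r; apply/orP; right; nia.
  have s2 : (9 <= s ^ 2)%N by rewrite !expnS expn0; nia.
  rewrite /B; move: (K ^ n)%N K1 (box_time I S M) hbox => X X1 b hb.
  have h1 : (X * (b + 50 * S) <= X * (150 * s ^ 2 * S))%N by rewrite leq_mul2l
    hb orbT.
  rewrite /K -muln2; clearbody S.
  move: (s ^ 2)%N s2 h1 => u u9 h1.
  apply: (@leq_trans ((8 * k + 250) * S + X * (150 * u * S))%N); first by lia.
  apply: (@leq_trans (X * ((8 * k + 250) * S) + X * (150 * u * S))%N).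
    by rewrite leq_add2r leq_pmull.
  have hu : (8 * k + 250 + 150 * u <= 200 * u * k)%N by nia.
  apply: (@leq_trans (X * ((8 * k + 250 + 150 * u) * S))%N); first by lia.
  by rewrite [leqRHS]mulnC leq_mul2l leq_mul2r hu !orbT.
apply: run_write_table => // m1 f1 m1_12.
apply: run_write_table => // m2 f2 m2_13.
apply: run_seq; apply: (@run_set_var _ _ _ _ _ _ K%:R) => //.
  by apply: nat_small; rewrite leq_addl.
(* Writing the tables leaves the other work arrays at zero, which supplies the initial answer flag
   and the digits of box 0. *)
have z a i : (3 < a)%N -> a \notin [:: 12; 13;
  18]%N -> update m2 18 0 K%:R a i = 0.
  rewrite !inE !negb_or => a3 /and3P[a12 a13 a18].
  by rewrite update_array// f2 ?inE// f1 ?inE// m_zero.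
apply: (run_search R eps k I m) => //.
- by lia.
- by move=> c; apply: box_query_size => // i; apply: digit_lt; lia.
- split.
  + by rewrite update_array// f2// f1.
  + by move=> p _; rewrite update_array// f2// f1.
  + by move=> i _; rewrite update_array// f2// f1.
  + by rewrite update_array// f2// f1.
  + by move=> i ik; rewrite update_array// f2// m1_12 ik.
  + by move=> i ik; rewrite update_array// m2_13 ik.
  + by rewrite update_same.
- by apply: z.
- by move=> j; apply: z.
Qed.

Theorem theorem3p2 (R : realType) :
  exists (dq dt : nat) (cq ct : nat -> nat -> nat -> R),
  forall eps : R, 0 < eps -> eps <= 1 ->
  exists P : cmd,
  forall O : oracle, solves_gap_cvp (2 : R) O ->
  forall (I : instance) (m : memory), initial m I ->
  exists (m' : memory) (T : nat) (qs : seq instance)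
         (ans : option 'cV[rat]_(cvp_dim I)),
    [/\ exec O P m m' T qs,
        outputs m' ans /\ gap_cvp_answer (1 + eps) ans,
        (size qs)%:R <= 2 ^+ cvp_dim I * (2 + log2 (1 / eps)) ^+ cvp_dim I,
        forall J : instance, List.In J qs ->
          (instance_size J)%:R <=
            poly3 dq cq (cvp_dim I)%:R (instance_size I)%:R (log2 (1 / eps))
      & T%:R <=
          poly3 dt ct (cvp_dim I)%:R (instance_size I)%:R (log2 (1 / eps))
          * (2 ^+ cvp_dim I * (2 + log2 (1 / eps)) ^+ cvp_dim I)].
Proof.
(* With [k <= 2 (1 + z)], the query size [21 s^3 k] gives the constant 42, and the time factor
   [200 s^2 k * 50 s^3 k] gives degree 5 in [s] and a further factor 4. *)
have [dq [cq hq]] := poly3_monomial R 42 3 1.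
have [dt [ct ht]] := poly3_monomial R (200 * 50 * 4) 5 2.
exists dq, dt, cq, ct => eps e0 e1.
have [k [k1 hk ek]] := cell_count_ex R eps e0 e1.
exists (gap_program k) => O Os I m init.
have [m' [T [qs [ex TB [sq hJ [ans hans]]]]]] :=
  run_gap_program R eps k O I m e0 k1 ek Os init.
exists m', T, qs, ans; rewrite hq ht cat0s in sq hJ *.
set z := log2 (1 / eps) in hk *; set s := instance_size I in TB hJ *.
have z0 : 0 <= z.
  rewrite divr_ge0 ?ln_ge0 ?ler1n// div1r invf_ge1//.
have hk2 : k%:R <= 2 * (1 + z) by lra.
have hX : (k.*2 ^ cvp_dim I)%:R <= 2 ^+ cvp_dim I * (2 + z) ^+ cvp_dim I :> R.
  rewrite natrX -exprMn lerXn2r ?nnegrE ?ler0n//; first by rewrite mulr_ge0//;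
    lra.
  by rewrite -mul2n natrM ler_pM2l.
have s0 a : 0 <= (s%:R : R) ^+ a by rewrite exprn_ge0.
split=> //.
- by apply: le_trans hX; rewrite ler_nat.
- move=> J /hJ; rewrite -(ler_nat R) => /le_trans; apply.
  have -> : (21 * s ^ 3 * k)%:R = 21 * s%:R ^+ 3 * k%:R :> R.
    by rewrite -natrX -!natrM.
  rewrite expr1; have -> : 42 * s%:R ^+ 3 * (1 + z) = 21 * s%:R ^+ 3 *
    (2 * (1 + z)) :> R by ring.
  by rewrite ler_wpM2l// mulr_ge0.
- apply: (@le_trans _ _ (200 * s ^ 2 * k * (50 * s ^ 3 * k) * k.*2 ^ cvp_dim
    I)%:R).
    by rewrite ler_nat.
  rewrite natrM; apply: ler_pM => //.
  have -> : (200 * s ^ 2 * k * (50 * s ^ 3 * k))%:R =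
      200 * s%:R ^+ 2 * k%:R * (50 * s%:R ^+ 3 * k%:R) :> R.
    by rewrite -!natrX -!natrM.
  have -> : 200 * s%:R ^+ 2 * k%:R * (50 * s%:R ^+ 3 * k%:R) =
     200 * 50 * s%:R ^+ 5 * k%:R ^+ 2 :> R by ring.
  have -> : 200 * 50 * 4 * s%:R ^+ 5 * (1 + z) ^+ 2 =
     200 * 50 * s%:R ^+ 5 * (2 * (1 + z)) ^+ 2 :> R by ring.
  rewrite ler_wpM2l ?mulr_ge0// lerXn2r ?nnegrE//; lra.
Qed.
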